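(* Let $F$ be a finite metric subspace of an infinite-dimensional Hilbert space $\mathcal H$. If all subspaces of $\mathcal H$ isometric to $F$ are coloured using finitely many colours, then for every finite subspace $G$ of $\mathcal H$ and every $\varepsilon>0$ there is an isometric copy $G'$ of $G$ in $\mathcal H$ such that the set of all subspaces of $G'$ isometric to $F$ is monochromatic up to $\varepsilon$.
   Context: ''Subspace'' means metric subspace (subset with the norm distance). The set of subspaces of $\mathcal H$ isometric to $F$ is regarded as the quotient, by the group $\mathrm{Iso}(F)$ of isometries of $F$ acting by precomposition, of the set of isometric embeddings $F\hookrightarrow\mathcal H$ equipped with the metric $d_{\sup}(i,j)=\max\{\|i(x)-j(x)\| : x\in F\}$; thus the distance between two such subspaces $F_1,F_2$ is the minimum of $d_{\sup}(i,j)$ over isometric embeddings $i,j$ of $F$ with $i(F)=F_1$, $j(F)=F_2$. A colouring with finitely many colours is a finite partition $\gamma$; a set of subspaces is monochromatic up to $\varepsilon$ if it is contained in the $\varepsilon$-neighbourhood of some member of $\gamma$. *)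

(* Defs.v *)
From HB Require Import structures.
From mathcomp Require Export all_boot all_order all_algebra.
From mathcomp Require Export finmap sesquilinear complex.
From mathcomp Require Export mathcomp_extra boolp classical_sets functions.
From mathcomp Require Export cardinality reals topology normedtype.
Export Order.TTheory GRing.Theory Num.Theory.
Export numFieldNormedType.Exports.

Set Implicit Arguments.
Unset Strict Implicit.
Unset Printing Implicit Defensive.

Local Open Scope classical_set_scope.
Local Open Scope ring_scope.

(* The scalar field of a Hilbert space together with its conjugation: either
   the real numbers R, or the complex numbers R[i]. *)
Inductive hilbert_scalars (R : realType) :
    forall K : numFieldType, (K -> K) -> Prop :=
| RealScalars : @hilbert_scalars R R idfun
| ComplexScalars : @hilbert_scalars R R[i] Num.conj.

(* Completeness is part of completeNormedModType. When K is R[i] the norm takes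
   its values in the nonnegative reals seen inside R[i]. *)
Definition is_hilbert (K : numFieldType) (conj : K -> K)
    (H : completeNormedModType K) : Prop :=
  exists dot : {dot H for conj}, forall x : H, dot x x = `|x| ^+ 2.

Definition finite_dimensional (K : numFieldType) (H : lmodType K) : Prop :=
  exists (n : nat) (e : 'I_n -> H),
    forall x : H, exists a : 'I_n -> K, x = \sum_(k < n) a k *: e k.

Section MetricSubspaces.
Variables (K : numFieldType) (H : normedModType K).
Implicit Types (F G : set H) (i j : H -> H).

(* An isometric embedding of F into H is given by a function i on H of which
   only the restriction to F matters. *)
Definition isometric_embedding F i : Prop :=
  forall x y, F x -> F y -> `|i x - i y| = `|x - y|.

Definition isometric_copies F : set (set H) :=
  [set F' | exists2 i, isometric_embedding F i & i @` F = F'].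

(* The maximum over a finite set F; norms are nonnegative, so starting at 0
   is harmless. *)
Definition dsup F i j : K :=
  \big[Num.max/0]_(x <- fset_set F) `|i x - j x|.

(* The values d_sup(i, j), for i and j running over the representatives of
   F1 and F2 modulo precomposition by the isometries of F. *)
Definition dsup_values F F1 F2 : set K :=
  [set r | exists i j,
     [/\ isometric_embedding F i /\ i @` F = F1,
         isometric_embedding F j /\ j @` F = F2 & r = dsup F i j]].

(* d is the distance between the copies F1 and F2 of F. *)
Definition copy_distance F F1 F2 (d : K) : Prop :=
  dsup_values F F1 F2 d /\ lbound (dsup_values F F1 F2) d.

Definition copies_nbhd F (eps : K) (A : set (set H)) : set (set H) :=
  [set F1 | isometric_copies F F1 /\
     exists F2 d, [/\ A F2, copy_distance F F1 F2 d & d < eps]].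

Definition finite_colouring F (gamma : set (set (set H))) : Prop :=
  finite_set gamma /\ partition gamma id (isometric_copies F).

Definition monochromatic_upto F (gamma : set (set (set H))) (eps : K)
    (C : set (set H)) : Prop :=
  exists2 A, gamma A & C `<=` copies_nbhd F eps A.

End MetricSubspaces.

(* Main.v *)
Require Import Defs.
From mathcomp Require Import fingroup perm ring lra zify.

(** The Ramsey property comes from concentration of measure in the powers of a
   finite permutation group.

   Only distances between points matter, so that everything happens in real
   Euclidean spaces of large finite dimension, which embed isometrically in
   the infinite-dimensional space.  If [F] has no copy inside [G] there is
   nothing to prove.  Otherwise let [y] be coordinates for [G] and [p0] one way
   of placing [F] in [G]; the other copies of [F] in [G] are images of this one
   by rigid motions.

   The first step replaces rigid motions by permutations.  By
   [permutation_model], [G] is isometric to a set of functions on a finite set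
   [Om], in such a way that any two congruent tuples in [G] are carried to each
   other, up to a small error, by a permutation of [Om].  Here [Om] is a large
   box in a lattice.  A product of reflections remains within bounded distance
   of a bijection of the lattice ([congruent_lattice_close]): with one more
   coordinate, a reflection becomes a half turn, which is a product of shears,
   and the shears in question can be rounded to bijections.  The function
   attached to [y] would ideally be a wide bump translated to [y], since rigid
   motions permute these exactly; it is taken to be the first order expansion
   of that translate in [y], called a wave, because the waves form an exactly
   isometric copy of [G] by the symmetries of the box
   ([box_second_moment]).  When [G] is magnified, and the bump is
   much wider still, rounding and the second order terms become negligible.

   The second step is combinatorial.  Put [M] copies of the model side by side,
   and let [th] in the power [Perm(Om)^M] move each of them independently.  All
   the resulting placements of [G] are isometric.  Colour [th] by the colour of
   the copy of [F] that it makes out of [p0].  One colour class [A] has density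
   bounded below, hence for large [M] almost every element of the power differs
   from some element of [A] in a small fraction of its coordinates
   ([hamming_concentration]).  Multiplication by a fixed element
   preserves the counting measure, so some [th] works simultaneously for the
   finitely many permutations that take the copy [p0] to the other ones
   ([hamming_colouring]); the placement of [G] given by this [th] is the one
   required ([euclidean_ramsey]). *)

Set Implicit Arguments.
Unset Strict Implicit.
Unset Printing Implicit Defensive.

Local Open Scope ring_scope.

(** * Euclidean space *)

Section EuclideanSpace.
Variables (R : realType) (n : nat).
Implicit Types (u v w : 'rV[R]_n) (a : R).

Definition dotv u v : R := \sum_i u 0 i * v 0 i.
Definition enorm u : R := Num.sqrt (dotv u u).

Lemma dotvC u v : dotv u v = dotv v u.
Proof. by apply: eq_bigr => i _; rewrite mulrC. Qed.

Lemma dotvDl u v w : dotv (u + v) w = dotv u w + dotv v w.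
Proof. by rewrite -big_split; apply: eq_bigr => i _; rewrite !mxE mulrDl. Qed.

Lemma dotvZl a u v : dotv (a *: u) v = a * dotv u v.
Proof. by rewrite mulr_sumr; apply: eq_bigr => i _; rewrite !mxE mulrA. Qed.

Lemma dotvNl u v : dotv (- u) v = - dotv u v.
Proof. by rewrite -scaleN1r dotvZl mulN1r. Qed.

Lemma dotvDr u v w : dotv u (v + w) = dotv u v + dotv u w.
Proof. by rewrite !(dotvC u) dotvDl. Qed.

Lemma dotvZr a u v : dotv u (a *: v) = a * dotv u v.
Proof. by rewrite !(dotvC u) dotvZl. Qed.

Lemma dotvNr u v : dotv u (- v) = - dotv u v.
Proof. by rewrite !(dotvC u) dotvNl. Qed.

Definition dotvE := (dotvDl, dotvDr, dotvNl, dotvNr, dotvZl, dotvZr).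

Lemma dotvv_ge0 u : 0 <= dotv u u.
Proof. by apply: sumr_ge0 => i _; rewrite -expr2 sqr_ge0. Qed.

Lemma dotvv_eq0 u : (dotv u u == 0) = (u == 0).
Proof.
apply/eqP/eqP => [|->]; last by apply: big1 => i _; rewrite !mxE mul0r.
move/eqP; rewrite psumr_eq0 => [/allP h|i _]; last by rewrite -expr2 sqr_ge0.
apply/rowP => i; rewrite mxE.
by have := h i (mem_index_enum i); rewrite -expr2 sqrf_eq0 => /eqP.
Qed.

Lemma sqr_enorm u : enorm u ^+ 2 = dotv u u.
Proof. by rewrite sqr_sqrtr // dotvv_ge0. Qed.

Lemma enorm_ge0 u : 0 <= enorm u.
Proof. exact: sqrtr_ge0. Qed.

Lemma enorm_le a u : 0 <= a -> (enorm u <= a) = (dotv u u <= a ^+ 2).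
Proof.
by move=> a0; rewrite -sqr_enorm ler_pXn2r // nnegrE // enorm_ge0.
Qed.

Lemma dotv_sqr_le u v : dotv u v ^+ 2 <= dotv u u * dotv v v.
Proof.
have [/eqP|v0] := boolP (dotv v v == 0).
  move=> vv0; have /eqP v0 : v == 0 by rewrite -dotvv_eq0 vv0.
  have -> : dotv u v = 0 by rewrite v0 -(scale0r 0) dotvZr mul0r.
  by rewrite vv0 mulr0 expr2 mul0r.
have vp : 0 < dotv v v by rewrite lt_def v0 dotvv_ge0.
have := dotvv_ge0 (dotv v v *: u - dotv u v *: v).
rewrite !dotvE (dotvC v u).
set p := dotv v v; set q := dotv u v; set r := dotv u u => h.
have : 0 <= p * (r * p - q ^+ 2) by apply: le_trans h _; rewrite le_eqVlt; apply/orP; left; apply/eqP; ring.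
by rewrite pmulr_rge0 // subr_ge0.
Qed.

Lemma normr_dotv_le u v : `|dotv u v| <= enorm u * enorm v.
Proof.
rewrite -(@ler_pXn2r _ 2) // ?nnegrE ?mulr_ge0 ?enorm_ge0 //.
by rewrite real_normK ?num_real // exprMn !sqr_enorm dotv_sqr_le.
Qed.

Lemma enormD u v : enorm (u + v) <= enorm u + enorm v.
Proof.
rewrite enorm_le ?addr_ge0 ?enorm_ge0 // !dotvE (dotvC v u).
have := le_trans (ler_norm _) (normr_dotv_le u v).
by rewrite sqrrD !sqr_enorm => h; lra.
Qed.

Lemma enormN u : enorm (- u) = enorm u.
Proof. by rewrite /enorm !dotvE opprK. Qed.

Lemma enormBC u v : enorm (u - v) = enorm (v - u).
Proof. by rewrite -enormN opprB. Qed.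

Lemma enorm_triangle w u v : enorm (u - v) <= enorm (u - w) + enorm (w - v).
Proof. by rewrite -[u - v](subrKA w) enormD. Qed.

Lemma enorm_subr_ge u v : enorm u - enorm v <= enorm (u - v).
Proof. by have := enormD (u - v) v; rewrite subrK; lra. Qed.

Lemma enorm_eq0 u : (enorm u == 0) = (u == 0).
Proof. by rewrite -dotvv_eq0 -sqr_enorm sqrf_eq0. Qed.

Lemma enormZ a u : enorm (a *: u) = `|a| * enorm u.
Proof.
by rewrite /enorm !dotvE mulrA -expr2 sqrtrM ?sqr_ge0 // sqrtr_sqr.
Qed.

Lemma normr_coord_le u i : `|u 0 i| <= enorm u.
Proof.
rewrite -(@ler_pXn2r _ 2) // ?nnegrE ?enorm_ge0 //.
rewrite real_normK ?num_real // sqr_enorm /dotv (bigD1 i) //= -expr2 lerDl.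
by apply: sumr_ge0 => j _; rewrite -expr2 sqr_ge0.
Qed.

Lemma enorm_le_sqrt u : (forall i, `|u 0 i| <= 1) -> enorm u <= Num.sqrt n%:R.
Proof.
move=> h; rewrite ler_wsqrtr //.
apply: (@le_trans _ _ (\sum_(i < n) 1)); last first.
  by rewrite sumr_const card_ord.
apply: ler_sum => i _; rewrite -expr2 -(real_normK (num_real _)).
by rewrite exprn_ile1.
Qed.

End EuclideanSpace.

(** * Rigid motions and bijections of the lattice *)

Section LatticeBijections.
Variable R : realType.

Definition lattice n (w : 'rV[int]_n) : 'rV[R]_n := map_mx intr w.

Lemma latticeD n (w1 w2 : 'rV[int]_n) :
  lattice (w1 + w2) = lattice w1 + lattice w2.
Proof. by rewrite /lattice map_mxD. Qed.

Definition lattice_close n (C : R) (g : 'rV[R]_n -> 'rV[R]_n) : Prop :=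
  exists s s' : 'rV[int]_n -> 'rV[int]_n,
    [/\ cancel s s', cancel s' s &
        forall w, enorm (lattice (s w) - g (lattice w)) <= C].

(** The error of the inner map is amplified by the Lipschitz constant of the
   outer one. *)
Lemma lattice_close_comp n (C1 C2 L : R) (g1 g2 : 'rV[R]_n -> 'rV[R]_n) :
  0 <= L -> (forall u v, enorm (g1 u - g1 v) <= L * enorm (u - v)) ->
  lattice_close C1 g1 -> lattice_close C2 g2 ->
  lattice_close (C1 + L * C2) (g1 \o g2).
Proof.
move=> L0 lip [s1 [s1' [k1 k1' h1]]] [s2 [s2' [k2 k2' h2]]].
exists (s1 \o s2), (s2' \o s1'); split.
- exact: can_comp.
- exact: can_comp.
move=> w /=; apply: le_trans (enorm_triangle (g1 (lattice (s2 w))) _ _) _.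
apply: lerD (h1 _) _; apply: le_trans (lip _ _) _.
exact: ler_wpM2l.
Qed.

Lemma normr_floor_sub (x : R) : `|(Num.floor x)%:~R - x| <= 1.
Proof.
have := floor_le_tmp x; have := floorD1_gt x; rewrite intrD => h1 h2.
by rewrite ler_norml; apply/andP; split; lra.
Qed.

Definition floorv n (u : 'rV[R]_n) : 'rV[int]_n := map_mx Num.floor u.

(** Adding a displacement rounded to the lattice can be undone when the
   displacement does not change along itself. *)
Lemma shear_lattice_close n (h : 'rV[R]_n -> 'rV[R]_n) :
  (forall w u, let k := floorv (h u) in
     h (lattice (w + k)) = h (lattice w) /\
     h (lattice (w - k)) = h (lattice w)) ->
  lattice_close (Num.sqrt n%:R) (fun u => u + h u).
Proof.
move=> hk; exists (fun w => w + floorv (h (lattice w))),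
  (fun w => w - floorv (h (lattice w))); split.
- by move=> w; rewrite (hk _ _).1 addrK.
- by move=> w; rewrite (hk _ _).2 subrK.
move=> w; rewrite latticeD opprD addrACA subrr add0r.
by apply: enorm_le_sqrt => i; rewrite !mxE normr_floor_sub.
Qed.

Section HalfTurn.
Variables (n : nat) (m : 'rV[R]_n.+1) (c : R).
Hypotheses (m_unit : dotv m m = 1) (m_last : m 0 ord_max = 0).
Implicit Types u v : 'rV[R]_n.+1.

Let e : 'rV[R]_n.+1 := delta_mx 0 ord_max.
Let last u : R := u 0 ord_max.

(** The product of the reflection in the hyperplane where the inner product with
   [m] is [c] and of the change of sign of the last coordinate: the half turn
   in the plane of [m] and of the last basis vector. *)
Definition half_turn u : 'rV[R]_n.+1 :=
  u - (2 * (dotv u m - c)) *: m - (2 * u 0 ord_max) *: e.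

Let dot_e u : dotv u e = last u.
Proof.
rewrite /dotv (bigD1 ord_max) //= !mxE !eqxx mulr1 big1 ?addr0 // => i ine.
by rewrite mxE (negPf ine) andbF mulr0.
Qed.

Let shear1 u := u + (- last u) *: m.
Let shear2 u := u + (dotv u m - c) *: e.

Let dot_me : dotv m e = 0. Proof. by rewrite dot_e. Qed.
Let dot_em : dotv e m = 0. Proof. by rewrite dotvC. Qed.
Let dot_ee : dotv e e = 1. Proof. by rewrite dot_e /last mxE !eqxx. Qed.

Let lastE u : last u = dotv u e. Proof. by rewrite dot_e. Qed.

Let normm : enorm m = 1. Proof. by rewrite /enorm m_unit sqrtr1. Qed.
Let norme : enorm e = 1. Proof. by rewrite /enorm dot_ee sqrtr1. Qed.

Let shear1_close : lattice_close (Num.sqrt n.+1%:R) shear1.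
Proof.
apply: shear_lattice_close => w u /=.
suff h : last (lattice (floorv (- last u *: m))) = 0.
  by split; rewrite /shear1 /lattice ?map_mxD ?map_mxN !lastE !dotvE -!lastE h
    ?oppr0 addr0.
by rewrite /last !mxE m_last mulr0 floor0.
Qed.

Let shear2_close : lattice_close (Num.sqrt n.+1%:R) shear2.
Proof.
apply: shear_lattice_close => w u /=.
suff h : dotv (lattice (floorv ((dotv u m - c) *: e))) m = 0.
  by split; rewrite /lattice ?map_mxD ?map_mxN !dotvE h ?oppr0 addr0.
rewrite /dotv big1 // => i _; rewrite !mxE.
have [->|ine] := eqVneq i ord_max; first by rewrite m_last mulr0.
by rewrite andbF mulr0 floor0 mul0r.
Qed.

Let shear1_lip u v : enorm (shear1 u - shear1 v) <= 2 * enorm (u - v).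
Proof.
rewrite /shear1 opprD addrACA -scaleNr -scalerDl.
apply: le_trans (enormD _ _) _; rewrite enormZ normm mulr1.
suff : `|- last u - - last v| <= enorm (u - v) by move=> h; lra.
rewrite -opprD normrN.
by have := normr_coord_le (u - v) ord_max; rewrite !mxE.
Qed.

Let shear2_lip u v : enorm (shear2 u - shear2 v) <= 2 * enorm (u - v).
Proof.
rewrite /shear2 opprD addrACA -scaleNr -scalerDl.
apply: le_trans (enormD _ _) _; rewrite enormZ norme mulr1.
suff : `|dotv u m - c - (dotv v m - c)| <= enorm (u - v) by move=> h; lra.
have -> : dotv u m - c - (dotv v m - c) = dotv (u - v) m.
  by rewrite !dotvE; ring.
by have := normr_dotv_le (u - v) m; rewrite normm mulr1.
Qed.

(* In a plane, three shears make a quarter turn, and two quarter turns make a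
   half turn. *)
Let half_turnE u :
  half_turn u = (shear1 \o (shear2 \o (shear1 \o
                  (shear1 \o (shear2 \o shear1))))) u.
Proof.
apply/rowP => i; rewrite /half_turn /= /shear1 /shear2 !lastE.
rewrite !dotvE !dot_me !dot_em !dot_ee !m_unit -/(last u) !lastE !mxE /=.
by ring.
Qed.

(** The constant is [1 + 2 + 4 + 8 + 16 + 32]: six shears, each with Lipschitz
   constant at most [2]. What matters is that it does not depend on [m] and
   [c], hence is not affected by magnifying a configuration. *)
Lemma half_turn_lattice_close :
  lattice_close (63 * Num.sqrt n.+1%:R) half_turn.
Proof.
set q : R := Num.sqrt _.
have -> : half_turn = shear1 \o (shear2 \o (shear1 \o
                  (shear1 \o (shear2 \o shear1)))).
  by apply/funext => u; rewrite half_turnE.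
have -> : 63 * q = q + 2 * (q + 2 * (q + 2 * (q + 2 * (q + 2 * q)))) by ring.
do 5! [apply: lattice_close_comp; [by []|by []|by []|]].
exact: shear1_close.
Qed.

Lemma half_turn_isometry u v :
  enorm (half_turn u - half_turn v) = enorm (u - v).
Proof.
set d := u - v.
have -> : half_turn u - half_turn v = d - (2 * dotv d m) *: m - (2 * last d) *: e.
  apply/rowP => i; rewrite /half_turn /d !lastE !dotvE -/(last u) -/(last v).
  by rewrite !lastE !mxE; ring.
move: d => d; rewrite /enorm !dotvE !dot_e (dotvC m d) (dotvC e d) dot_e m_unit.
have -> : last m = 0 by [].
by rewrite -(dot_e e) dot_ee dot_em; congr Num.sqrt; ring.
Qed.

Lemma half_turn_fix u : u 0 ord_max = 0 -> dotv u m = c -> half_turn u = u.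
Proof.
by move=> u0 uc; rewrite /half_turn u0 uc subrr !mulr0 !scale0r !subr0.
Qed.

Lemma half_turn_last u : u 0 ord_max = 0 -> half_turn u 0 ord_max = 0.
Proof. by move=> u0; rewrite !mxE u0 m_last !mulr0 mul0r !subr0. Qed.

End HalfTurn.

(** Reflections in perpendicular bisectors move the points of the first
   configuration to their targets one after another: the targets that have been
   reached are equidistant from the current image of the next point and from its
   target, so they lie on the bisector and stay in place. *)
Lemma congruent_lattice_close n k (x x' : 'I_k -> 'rV[R]_n.+1) :
  (forall a, x a 0 ord_max = 0) -> (forall a, x' a 0 ord_max = 0) ->
  (forall a b, enorm (x a - x b) = enorm (x' a - x' b)) ->
  exists g : 'rV[R]_n.+1 -> 'rV[R]_n.+1,
    [/\ forall u v, enorm (g u - g v) = enorm (u - v),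
        forall a, g (x a) = x' a &
        lattice_close (k%:R * (63 * Num.sqrt n.+1%:R)) g].
Proof.
move=> x0 x'0 xx'; set q : R := 63 * _.
have q0 : 0 <= q by rewrite mulr_ge0 // sqrtr_ge0.
suff /(_ k (leqnn k)) [g [g1 _ g2 g3]] : forall j, (j <= k)%N ->
  exists g : 'rV[R]_n.+1 -> 'rV[R]_n.+1,
    [/\ forall u v, enorm (g u - g v) = enorm (u - v),
        forall u : 'rV[R]_n.+1, u 0 ord_max = 0 -> g u 0 ord_max = 0,
        forall a : 'I_k, (a < j)%N -> g (x a) = x' a &
        lattice_close (j%:R * q) g].
  by exists g; split=> // a; apply: g2.
elim=> [_|j IH jk].
  exists id; split=> //; rewrite mul0r; exists id, id; split=> // w.
  by rewrite subrr -(scale0r 0) enormZ normr0 mul0r.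
have [g [gi gl gx [s [s' [k1 k2 gs]]]]] := IH (ltnW jk).
pose b := Ordinal jk; pose z := g (x b); pose z' := x' b.
have stepx (f : 'rV[R]_n.+1 -> 'rV[R]_n.+1) : f z = z' ->
    (forall a : 'I_k, (a < j)%N -> f (x' a) = x' a) ->
    forall a : 'I_k, (a < j.+1)%N -> f (g (x a)) = x' a.
  move=> fz fx a; rewrite ltnS leq_eqVlt => /orP[/eqP aj|aj].
    by have -> : a = b by apply/val_inj.
  by rewrite gx // fx.
have [zz'|zz'] := eqVneq z z'.
  exists g; split=> //; first exact: (@stepx id).
  exists s, s'; split=> // w; apply: le_trans (gs w) _.
  by rewrite ler_wpM2r // ler_nat.
have z0 : z 0 ord_max = 0 by apply: gl.
have d0 : 0 < enorm (z' - z).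
  by rewrite lt_def enorm_ge0 enorm_eq0 subr_eq0 eq_sym zz'.
pose r := (enorm (z' - z))^-1; pose m : 'rV[R]_n.+1 := r *: (z' - z).
have rd : r ^+ 2 * dotv (z' - z) (z' - z) = 1.
  by rewrite -sqr_enorm -exprMn mulVf ?expr1n // lt0r_neq0.
have m1 : dotv m m = 1 by rewrite !(dotvZl, dotvZr) mulrA -expr2 rd.
have m0 : m 0 ord_max = 0 by rewrite !mxE z0 x'0 subrr mulr0.
pose c := (dotv z m + dotv z' m) / 2.
have fixed (a : 'I_k) : (a < j)%N -> half_turn m c (x' a) = x' a.
  move=> aj; apply: half_turn_fix => //.
  have : enorm (x' a - z) = enorm (x' a - z').
    by rewrite -(gx a aj) gi xx' gx.
  move/(congr1 (fun t => t ^+ 2)); rewrite !sqr_enorm /c /m !dotvE.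
  rewrite (dotvC z' z) (dotvC z (x' a)) (dotvC z' (x' a)) => h.
  have -> : dotv (x' a) z' = dotv (x' a) z + (dotv z' z' - dotv z z) / 2.
    by move: h; lra.
  by field.
have moved : half_turn m c z = z'.
  rewrite /half_turn z0 mulr0 scale0r subr0 /c.
  have -> : 2 * (dotv z m - (dotv z m + dotv z' m) / 2) = - (r * dotv (z' - z) (z' - z)).
    rewrite /m !(dotvZr, dotvZl) !dotvE (dotvC z' z); by field.
  by rewrite scaleNr opprK /m scalerA mulrAC -expr2 rd scale1r addrC subrK.
exists (half_turn m c \o g); split.
- by move=> u v /=; rewrite half_turn_isometry.
- by move=> u u0; apply: half_turn_last => //; apply: gl.
- exact: stepx.
have -> : j.+1%:R * q = q + 1 * (j%:R * q) by rewrite mulrSr; ring.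
apply: lattice_close_comp => //.
- by move=> u v; rewrite half_turn_isometry // mul1r.
- exact: half_turn_lattice_close.
- by exists s, s'.
Qed.

End LatticeBijections.

(** * Waves in a box of the lattice *)

(** A transposition corrects the permutation at one more point of [A] without
   disturbing the points already dealt with. *)
Lemma perm_extension (T : finType) (A : {set T}) (f : T -> T) :
  {in A &, injective f} -> exists s : {perm T}, {in A, s =1 f}.
Proof.
move eN: #|A| => N; elim: N A eN => [|N IH] A cA fi.
  by exists 1%g => x; rewrite (cards0_eq cA) inE.
have /card_gt0P[x xA] : (0 < #|A|)%N by rewrite cA.
have [||s sf] := IH (A :\ x).
- by move: cA; rewrite (cardsD1 x A) xA => -[].
- by move=> y z /setD1P[_ yA] /setD1P[_ zA]; apply: fi.
exists (s * tperm (s x) (f x))%g => y yA; rewrite permM.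
have [->|yx] := eqVneq y x; first by rewrite tpermL.
have sy : s y = f y by rewrite sf // in_setD1 yx.
rewrite tpermD //; first by rewrite (inj_eq perm_inj) eq_sym.
by rewrite sy; apply: contraNneq yx => /fi ->.
Qed.

Section Bump.
Variables (R : realType) (n : nat) (r : R).
Implicit Types u v y : 'rV[R]_n.

Definition bump u : R := Num.max 0 (r ^+ 2 - dotv u u).
(** The expansion of [bump (u - y) ^+ 2] to first order in [y]. *)
Definition wave y u : R := bump u ^+ 2 + 4 * bump u * dotv u y.

Lemma bump_ge0 u : 0 <= bump u.
Proof. by rewrite le_max lexx. Qed.

Lemma bump_le u : bump u <= r ^+ 2.
Proof. by rewrite ge_max sqr_ge0 /= lerBlDr lerDl dotvv_ge0. Qed.

Hypothesis r_ge0 : 0 <= r.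

Lemma bump0 u : r <= enorm u -> bump u = 0.
Proof.
move=> ru; apply/max_idPl; rewrite subr_le0 -sqr_enorm.
by rewrite ler_pXn2r // nnegrE // enorm_ge0.
Qed.

Lemma wave0 y u : r <= enorm u -> wave y u = 0.
Proof. by move=> /bump0 u0; rewrite /wave u0 mulr0 mul0r expr2 mul0r addr0. Qed.

(** The square of the positive part has a Lipschitz derivative; this is why the
   bump is squared. *)
Lemma sqr_pos_part_taylor (a b : R) :
  0 <= Num.max 0 a ^+ 2 - Num.max 0 b ^+ 2 - 2 * Num.max 0 b * (a - b)
    <= (a - b) ^+ 2.
Proof.
have := sqr_ge0 (a - b); have := sqr_ge0 a; have := sqr_ge0 b.
rewrite !expr2.
case: (leP 0 a) => a0; case: (leP 0 b) => b0 h1 h2 h3; apply/andP; split; nra.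

Qed.

Lemma wave_near_translate y u : enorm y <= r ->
  `|wave y u - bump (u - y) ^+ 2| <= 25 * r ^+ 2 * enorm y ^+ 2.
Proof.
move=> yr; have y0 := enorm_ge0 y.
have [ur|ur] := leP (2 * r) (enorm u).
  rewrite wave0; last by lra.
  rewrite bump0; last by have := enorm_subr_ge u y; lra.
  by rewrite expr2 mul0r subrr normr0 !mulr_ge0 ?exprn_ge0.
have /andP := sqr_pos_part_taylor (r ^+ 2 - dotv (u - y) (u - y))
                                  (r ^+ 2 - dotv u u).
rewrite -/(bump _) -/(bump u).
have -> : r ^+ 2 - dotv (u - y) (u - y) - (r ^+ 2 - dotv u u) =
          2 * dotv u y - enorm y ^+ 2.
  by rewrite sqr_enorm !dotvE (dotvC y u); ring.
rewrite /wave; set A := bump _; set B := bump u; set Y := enorm y.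
set D := dotv u y => -[h1 h2].
have dB : `|D| <= 2 * r * Y.
  apply: le_trans (normr_dotv_le _ _) _; rewrite ler_wpM2r //.
  exact: ltW.
have d2 : (2 * D - Y ^+ 2) ^+ 2 <= (5 * r * Y) ^+ 2.
  rewrite -[X in X <= _]real_normK ?num_real // ler_pXn2r ?nnegrE //;
    last by rewrite !mulr_ge0.
  apply: le_trans (ler_normB _ _) _; rewrite normrM normrX.
  have : `|Y| * `|Y| <= r * Y by rewrite !ger0_norm // ler_wpM2r.
  rewrite ger0_norm // expr2; lra.
have B0 : 0 <= B := bump_ge0 u.
have Br : B <= r ^+ 2 := bump_le u.
have BY : B * Y ^+ 2 <= r ^+ 2 * Y ^+ 2 by rewrite ler_wpM2r ?exprn_ge0.
have BY0 : 0 <= B * Y ^+ 2 by rewrite mulr_ge0 ?exprn_ge0.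
rewrite ler_norml; apply/andP; split; nra.
Qed.

Lemma bump_sqr_lipschitz (C : R) u v : C <= r -> enorm (u - v) <= C ->
  `|bump u ^+ 2 - bump v ^+ 2| <= 6 * C * r ^+ 3.
Proof.
move=> Cr; wlog uv : u v / enorm u <= enorm v => [th|] uvC.
  have [h|/ltW h] := leP (enorm u) (enorm v); first exact: th.
  by rewrite distrC th // enormBC.
have C0 : 0 <= C := le_trans (enorm_ge0 _) uvC.
have [ur|ur] := leP r (enorm u).
  rewrite !bump0 ?(le_trans ur uv) //.
  by rewrite subrr normr0 !mulr_ge0 ?exprn_ge0.
have vuC : enorm v - enorm u <= C.
  by have := enorm_subr_ge v u; rewrite enormBC; lra.
have u0 := enorm_ge0 u.
have B0 := bump_ge0 u; have B1 := bump_le u.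
have b0 := bump_ge0 v; have b1 := bump_le v.
have [d0 d1] : 0 <= bump u - bump v /\ bump u - bump v <= 3 * r * C.
  move: B0 B1 b0 b1; rewrite /bump -!sqr_enorm.
  have sq : enorm v ^+ 2 - enorm u ^+ 2 <= 3 * r * C.
    by rewrite subr_sqr; nra.
  have sq0 : enorm u ^+ 2 <= enorm v ^+ 2 by rewrite ler_pXn2r // nnegrE enorm_ge0.
  have rC : 0 <= r * C by rewrite mulr_ge0.
  case: (leP 0 (r ^+ 2 - enorm u ^+ 2)) => ?;
    case: (leP 0 (r ^+ 2 - enorm v ^+ 2)) => ?; split; lra.
rewrite subr_sqr normrM (ger0_norm d0) ger0_norm ?addr_ge0 //.
have -> : 6 * C * r ^+ 3 = (3 * r * C) * (r ^+ 2 + r ^+ 2) by ring.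
by apply: ler_pM => //; [apply: addr_ge0|apply: lerD].
Qed.

End Bump.

(** The translate of the bump to [y] is carried exactly to its translate to
   [g y] by [g]; replacing translates by waves costs the first term of the error, and replacing
   [g u] by a nearby point [v] costs the second one.  Waves at distinct points
   differ by about [r ^+ 3] times the distance of these points. *)
Lemma wave_intertwined (R : realType) n (r C Y : R)
    (g : 'rV[R]_n -> 'rV[R]_n) (y u v : 'rV[R]_n) :
  0 <= r -> C <= r -> Y <= r ->
  (forall u v, enorm (g u - g v) = enorm (u - v)) ->
  enorm y <= Y -> enorm (g y) <= Y -> enorm (v - g u) <= C ->
  `|wave r (g y) v - wave r y u| <= 50 * r ^+ 2 * Y ^+ 2 + 6 * C * r ^+ 3.
Proof.
move=> r0 Cr Yr gi yY gyY vC.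
have h1 := wave_near_translate r0 v (le_trans gyY Yr).
have h2 := wave_near_translate r0 u (le_trans yY Yr).
have h3 : `|bump r (v - g y) ^+ 2 - bump r (g u - g y) ^+ 2| <= 6 * C * r ^+ 3.
  by apply: bump_sqr_lipschitz; rewrite // opprB addrA subrK.
have h4 : bump r (g u - g y) = bump r (u - y).
  by rewrite /bump -!sqr_enorm gi.
have Y2 z : enorm z <= Y -> 25 * r ^+ 2 * enorm z ^+ 2 <= 25 * r ^+ 2 * Y ^+ 2.
  move=> zY; rewrite ler_wpM2l ?mulr_ge0 ?exprn_ge0 // ler_pXn2r // nnegrE.
    exact: enorm_ge0.
  exact: le_trans (enorm_ge0 _) zY.
move: h1 h2 h3 (Y2 _ _ yY) (Y2 _ _ gyY); rewrite h4 !ler_norml.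
move=> /andP[? ?] /andP[? ?] /andP[? ?] ? ?; apply/andP; split; lra.
Qed.

Section Box.
Variables (R : realType) (n L : nat).
Let box := 'rV['I_(L.*2).+1]_n.

Definition box_point (o : box) : 'rV[int]_n := \row_i ((o 0 i)%:Z - L%:Z).
Definition point_box (w : 'rV[int]_n) : box := \row_i inord (absz (w 0 i + L%:Z)).
Let pt (o : box) : 'rV[R]_n := lattice R (box_point o).

Lemma box_pointK : cancel box_point point_box.
Proof.
move=> o; apply/rowP => i; rewrite !mxE subrK /=.
by rewrite inord_val.
Qed.

Lemma point_boxK (w : 'rV[int]_n) : (forall i, (absz (w 0%R i) <= L)%N) ->
  box_point (point_box w) = w.
Proof.
move=> wL; apply/rowP => i; rewrite !mxE; have := wL i => h.
rewrite inordK; [lia|rewrite ltnS -addnn; lia].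
Qed.

Lemma box_point_le o i : (absz (box_point o 0%R i) <= L)%N.
Proof. by rewrite mxE; move: (ltn_ord (o 0 i)); move: (nat_of_ord _) => k; lia. Qed.

Variable F : R -> R.
Let weight o := F (dotv (pt o) (pt o)).

(** The sign of one coordinate can be reversed. *)
Lemma box_moment_offdiag i j : i != j ->
  \sum_o weight o * (pt o 0 i * pt o 0 j) = 0.
Proof.
move=> ij.
pose f (o : box) : box := \row_k if k == i then rev_ord (o 0 k) else o 0 k.
have fK : cancel f f.
  by move=> o; apply/rowP => k; rewrite !mxE; case: eqP => // _; rewrite rev_ordK.
have ptf o k : pt (f o) 0 k = if k == i then - pt o 0 k else pt o 0 k.
  rewrite !mxE; case: eqP => // _; rewrite -rmorphN /=; congr intr.
  by move: (ltn_ord (o 0 k)); move: (nat_of_ord _) => /= t; lia.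
apply/eqP; rewrite -[_ == 0](@mulrn_eq0 R _ 2) mulr2n.
rewrite {1}(reindex_inj (can_inj fK)) -big_split big1 //= => o _.
have -> : weight (f o) = weight o.
  congr F; apply: eq_bigr => k _; rewrite !ptf.
  by case: eqP => // _; rewrite mulrNN.
by rewrite !ptf eqxx eq_sym (negPf ij) mulNr mulrN addNr.
Qed.

(** Two coordinates can be exchanged. *)
Lemma box_moment_diag i j :
  \sum_o weight o * pt o 0 i ^+ 2 = \sum_o weight o * pt o 0 j ^+ 2.
Proof.
pose f (o : box) : box := \row_k o 0 (tperm i j k).
have fK : cancel f f by move=> o; apply/rowP => k; rewrite !mxE tpermK.
rewrite [LHS] (reindex_inj (can_inj fK)); apply: eq_bigr => o _.
have ptf k : pt (f o) 0 k = pt o 0 (tperm i j k) by rewrite !mxE.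
rewrite ptf tpermL; suff -> : weight (f o) = weight o by []; congr F.
rewrite [RHS](reindex_inj (@perm_inj _ (tperm i j))).
by apply: eq_bigr => k _; rewrite ptf.
Qed.

(** A symmetric box has an isotropic inertia form, so linear forms on it make up
   an isometric copy of Euclidean space up to scale. *)
Lemma box_second_moment i (y : 'rV[R]_n) :
  \sum_o weight o * dotv (pt o) y ^+ 2 =
  (\sum_o weight o * pt o 0 i ^+ 2) * dotv y y.
Proof.
have -> : \sum_o weight o * dotv (pt o) y ^+ 2 =
  \sum_j \sum_k y 0 j * y 0 k * \sum_o weight o * (pt o 0 j * pt o 0 k).
  transitivity (\sum_o \sum_j \sum_k
      y 0 j * y 0 k * (weight o * (pt o 0 j * pt o 0 k))).
    apply: eq_bigr => o _; rewrite expr2 mulr_suml mulr_sumr.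
    apply: eq_bigr => j _; rewrite mulr_sumr mulr_sumr.
    by apply: eq_bigr => k _; ring.
  rewrite exchange_big; apply: eq_bigr => j _.
  by rewrite exchange_big; apply: eq_bigr => k _; rewrite mulr_sumr.
rewrite mulr_sumr; apply: eq_bigr => j _.
rewrite (bigD1 j) //= [X in _ + X]big1 ?addr0 => [|k kj].
  rewrite (box_moment_diag i j) [RHS]mulrC; congr (_ * _).
by rewrite box_moment_offdiag ?mulr0 // eq_sym.
Qed.

End Box.

(** The points whose coordinates all lie between [m] and [2 * m] are in the ball
   of radius [r / 2], where the bump is at least [3 / 4] of its maximum. *)
Lemma box_moment_lower_bound (R : realType) n m (r : R) :
  r = (4 * n.+1 * m)%:R ->
  9 * r ^+ 4 * m%:R ^+ 2 * m%:R ^+ n.+1 <=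
  \sum_(o : 'rV['I_((8 * n.+1 * m).*2).+1]_n.+1)
     16 * bump r (lattice R (box_point o)) ^+ 2
        * lattice R (box_point o) 0 0 ^+ 2.
Proof.
move=> rE; set L := (8 * n.+1 * m)%N.
pose f (p : 'rV['I_m]_n.+1) : 'rV['I_(L.*2).+1]_n.+1 :=
  \row_i inord (L + m + p 0%R i)%N.
have fv p i : f p 0 i = (L + m + p 0%R i)%N :> nat.
  rewrite mxE inordK // ltnS -addnn; have := ltn_ord (p 0 i).
  by rewrite /L; nia.
have fi : injective f.
  move=> p q pq; apply/rowP => i; apply/val_inj/(@addnI (L + m)).
  by rewrite /= -!fv pq.
have ptf p i : lattice R (box_point (f p)) 0 i = (m + p 0%R i)%:R.
  rewrite /lattice mxE [in LHS]mxE fv pmulrn; congr (_%:~R); lia.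
have -> : 9 * r ^+ 4 * m%:R ^+ 2 * m%:R ^+ n.+1 =
    \sum_(p : 'rV['I_m]_n.+1) 9 * r ^+ 4 * m%:R ^+ 2.
  by rewrite sumr_const card_mx card_ord mul1n -[RHS]mulr_natr natrX.
apply: (@le_trans _ _ (\sum_(o in [set f p | p : 'rV['I_m]_n.+1])
     16 * bump r (lattice R (box_point o)) ^+ 2
        * lattice R (box_point o) 0 0 ^+ 2)); last first.
  rewrite [leRHS](bigID (mem [set f p | p : 'rV['I_m]_n.+1])) /= lerDl.
  by apply: sumr_ge0 => o _; apply: mulr_ge0 (sqr_ge0 _); apply: mulr_ge0 (sqr_ge0 _).
rewrite big_imset /=; last by move=> p q _ _; apply: fi.
rewrite [leRHS](eq_bigl xpredT) //; apply: ler_sum => p _.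
set P := lattice R _.
have P0 : m%:R ^+ 2 <= P 0 0 ^+ 2.
  by rewrite ler_pXn2r ?nnegrE ?ler0n // ptf ?ler_nat ?ler0n ?leq_addr.
have PP : 4 * dotv P P <= r ^+ 2.
  have : dotv P P <= \sum_(i < n.+1) (4 * m%:R ^+ 2).
    apply: ler_sum => i _; rewrite ptf -!natrM -natrX -natrM ler_nat.
    by have := ltn_ord (p 0 i); nia.
  rewrite sumr_const card_ord -mulr_natr => h.
  apply: (@le_trans _ _ (4 * (4 * m%:R ^+ 2 * n.+1%:R))); first by lra.
  rewrite rE -!natrX -!natrM ler_nat; nia.
have bP : 3 * r ^+ 2 <= 4 * bump r P.
  by move: PP (sqr_ge0 r); rewrite /bump; move: (dotv P P) (r ^+ 2) => d q; case: (leP 0 (q - d)) => ? ? ?; lra.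
have bP2 : 9 * r ^+ 4 <= 16 * bump r P ^+ 2.
  have -> : 9 * r ^+ 4 = (3 * r ^+ 2) ^+ 2 by ring.
  have -> : 16 * bump r P ^+ 2 = (4 * bump r P) ^+ 2 by ring.
  by rewrite ler_pXn2r // nnegrE mulr_ge0 ?sqr_ge0 ?bump_ge0.
apply: ler_pM => //; last exact: sqr_ge0.
by apply: mulr_ge0 => //; rewrite -[4%N]/(2 * 2)%N exprM sqr_ge0.
Qed.

(** Scaling the configuration by a large factor [t] makes the rounding error
   [C] negligible, and then taking the radius [r] of the bump much larger than
   [t] makes the waves nearly exact translates. *)
Lemma scale_and_radius (R : realType) (n : nat) (C Y K eps : R) :
  0 <= C -> 0 <= Y -> 0 <= K -> 0 < eps ->
  exists t : R, exists m : nat, exists r : R,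
    [/\ 0 < t, (0 < m)%N, r = (4 * n.+1 * m)%:R, C + 2 * (t * Y) <= r &
        K * (50 * r ^+ 2 * (t * Y) ^+ 2 + 6 * C * r ^+ 3) ^+ 2 <=
          eps * (r ^+ 3 * t) ^+ 2].
Proof.
move=> C0 Y0 K0 eps0.
pose q := eps / (K + 1).
have q0 : 0 < q by rewrite divr_gt0 // ltr_wpDl.
pose h := Num.sqrt q.
have h0 : 0 < h by rewrite sqrtr_gt0.
pose t := 12 * C / h + 1.
have t0 : 0 < t by rewrite ltr_wpDl // !mulr_ge0 // invr_ge0 ltW.
have Ct : 12 * C <= h * t.
  by rewrite /t mulrDr mulr1 mulrCA divff ?gt_eqF // mulr1 lerDl ltW.
pose B := C + 2 * (t * Y) + 100 * (t * Y ^+ 2) / h.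
pose m := (Num.truncn B).+1.
have Bm : B <= m%:R by exact/ltW/truncnS_gt.
pose r : R := (4 * n.+1 * m)%:R.
have mr : m%:R <= r by rewrite ler_nat leq_pmull.
have tY : 0 <= t * Y ^+ 2 by rewrite mulr_ge0 ?exprn_ge0 // ltW.
have tY1 : 0 <= t * Y by rewrite mulr_ge0 // ltW.
have r0 : 0 < r by apply: lt_le_trans mr; rewrite ltr0n.
have B2 : 100 * (t * Y ^+ 2) <= h * r.
  rewrite [leRHS]mulrC -ler_pdivrMr //; apply: le_trans (le_trans Bm mr).
  by rewrite /B lerDr addr_ge0 // mulr_ge0.
exists t, m, r; split=> //.
  apply: le_trans (le_trans Bm mr); rewrite /B lerDl.
  by rewrite divr_ge0 ?mulr_ge0 // ltW.
set E := 50 * r ^+ 2 * _ + _.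
have E0 : 0 <= E.
  by rewrite addr_ge0 // !mulr_ge0 ?exprn_ge0 // ltW.
have Eh : E <= h * (r ^+ 3 * t).
  have -> : E = r ^+ 2 * t * (50 * (t * Y ^+ 2)) + r ^+ 3 * (6 * C).
    by rewrite /E; ring.
  have h1 : r ^+ 2 * t * (50 * (t * Y ^+ 2)) <= r ^+ 2 * t * (h * r / 2).
    by rewrite ler_wpM2l; [|rewrite mulr_ge0 ?exprn_ge0 // ltW|lra].
  have h2 : r ^+ 3 * (6 * C) <= r ^+ 3 * (h * t / 2).
    by rewrite ler_wpM2l; [|rewrite exprn_ge0 // ltW|lra].
  have -> : h * (r ^+ 3 * t) = r ^+ 2 * t * (h * r / 2) + r ^+ 3 * (h * t / 2).
    by field.
  exact: lerD.
apply: (@le_trans _ _ (K * (h * (r ^+ 3 * t)) ^+ 2)).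
  rewrite ler_wpM2l // ler_pXn2r // nnegrE mulr_ge0 ?ltW //.
  by rewrite mulr_gt0 // exprn_gt0.
rewrite exprMn mulrA ler_wpM2r ?sqr_ge0 // sqr_sqrtr; last exact: ltW.
rewrite /q mulrCA; apply: ler_piMr; first exact: ltW.
by rewrite ler_pdivrMr; lra.
Qed.

(** The box has at most [(17 * n.+1 * M) ^ n.+1] points, a bounded multiple of
   the number [M ^ n.+1] of points that contribute to the lower bound on the
   inertia [c]; hence a pointwise error [E] that is small compared with
   [r ^+ 3 * t] is small in mean square. *)
Lemma box_error_bound (R : realType) n M (r t E eps c : R) :
  0 <= eps -> r = (4 * n.+1 * M)%:R ->
  9 * r ^+ 4 * M%:R ^+ 2 * M%:R ^+ n.+1 <= c ->
  (17 * n.+1)%:R ^+ n.+1 * (16 * n.+1%:R ^+ 2) * E ^+ 2 <=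
    9 * eps * (r ^+ 3 * t) ^+ 2 -> (0 < M)%N ->
  (((8 * n.+1 * M).*2).+1 ^ n.+1)%:R * E ^+ 2 <= eps * (t ^+ 2 * c).
Proof.
move=> eps0 rE cL Kr M0.
have cardM : (((8 * n.+1 * M).*2).+1 ^ n.+1)%:R <=
    (17 * n.+1)%:R ^+ n.+1 * M%:R ^+ n.+1 :> R.
  rewrite -exprMn -natrM -natrX ler_nat leq_exp2r //.
  by rewrite -addnn; nia.
apply: (@le_trans _ _ ((17 * n.+1)%:R ^+ n.+1 * M%:R ^+ n.+1 * E ^+ 2)).
  by rewrite ler_wpM2r // sqr_ge0.
apply: (@le_trans _ _ (eps * (t ^+ 2 * (9 * r ^+ 4 * M%:R ^+ 2 * M%:R ^+ n.+1)))).
  have r3 : (r ^+ 3 * t) ^+ 2 = 16 * n.+1%:R ^+ 2 * (r ^+ 4 * M%:R ^+ 2 * t ^+ 2).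
    have -> : (r ^+ 3 * t) ^+ 2 = r ^+ 2 * (r ^+ 4 * t ^+ 2) by ring.
    have -> : r ^+ 2 = 16 * n.+1%:R ^+ 2 * M%:R ^+ 2 by rewrite rE !natrM; ring.
    ring.
  have n0 : 0 < 16 * n.+1%:R ^+ 2 :> R by rewrite mulr_gt0 ?exprn_gt0.
  rewrite -(ler_pM2l n0); move: Kr; rewrite r3 => Kr.
  have : 0 <= M%:R ^+ n.+1 :> R by rewrite exprn_ge0.
  move: Kr; move: (M%:R ^+ n.+1) ((17 * n.+1)%:R ^+ n.+1) => u v Kr u0.
  have := ler_wpM2l u0 Kr.
  by congr (_ <= _); ring.
by rewrite ler_wpM2l // ler_wpM2l // sqr_ge0.
Qed.

(** The bijection of the lattice that follows a rigid motion need not preserve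
   the box, but it does so well inside, and outside of the ball where
   the bump lives the permutation may be arbitrary. *)
Lemma permutation_model (R : realType) n m k (y : 'I_m -> 'rV[R]_n.+1) (eps : R) :
  0 < eps -> (forall j, y j 0 ord_max = 0) ->
  exists (Om : finType) (f : 'I_m -> Om -> R),
    (forall i j, \sum_o (f i o - f j o) ^+ 2 = enorm (y i - y j) ^+ 2) /\
    forall p q : 'I_k -> 'I_m,
      (forall a b, enorm (y (p a) - y (p b)) = enorm (y (q a) - y (q b))) ->
      exists s : {perm Om},
        forall a, \sum_o (f (q a) (s o) - f (p a) o) ^+ 2 <= eps.
Proof.
move=> eps0 y0.
pose C : R := k%:R * (63 * Num.sqrt n.+1%:R).
pose Y : R := \sum_j enorm (y j).
have yY j : enorm (y j) <= Y.
  rewrite /Y (bigD1 j) //= lerDl.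
  by apply: sumr_ge0 => i _; apply: enorm_ge0.
have Y0 : 0 <= Y by apply: sumr_ge0 => i _; apply: enorm_ge0.
have C0 : 0 <= C by rewrite !mulr_ge0 // sqrtr_ge0.
pose K : R := (17 * n.+1)%:R ^+ n.+1 * (16 * n.+1%:R ^+ 2).
have K0 : 0 <= K by rewrite !mulr_ge0 ?exprn_ge0.
have eps9 : 0 < 9 * eps by rewrite mulr_gt0.
have [t [M [r [t0 M0 rE rC Kr]]]] := scale_and_radius n C0 Y0 K0 eps9.
have tY0 : 0 <= t * Y by rewrite mulr_ge0 // ltW.
have r0 : 0 <= r by rewrite rE ler0n.
have r1 : 0 < r by rewrite rE ltr0n !muln_gt0 M0.
(* The half side of the box is twice the radius of the bump, which leaves room
   for the bounded displacements. *)
pose L := (8 * n.+1 * M)%N.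
have LE : L%:R = 2 * r by rewrite rE -natrM; congr (_%:R); rewrite /L; nia.
pose Om := 'rV['I_(L.*2).+1]_n.+1 : finType.
pose pt (o : Om) : 'rV[R]_n.+1 := lattice R (box_point o).
pose c : R := \sum_(o : Om) 16 * bump r (pt o) ^+ 2 * pt o 0 0 ^+ 2.
have cL : 9 * r ^+ 4 * M%:R ^+ 2 * M%:R ^+ n.+1 <= c.
  exact: box_moment_lower_bound.
have M0' : 0 < M%:R :> R by rewrite ltr0n.
have c0 : 0 < c.
  by apply: lt_le_trans cL; rewrite !mulr_gt0 ?exprn_gt0.
pose d : R := t * Num.sqrt c.
have d0 : 0 < d by rewrite mulr_gt0 // sqrtr_gt0.
have d2 : d ^+ 2 = t ^+ 2 * c by rewrite exprMn sqr_sqrtr // ltW.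
pose f j (o : Om) := wave r (t *: y j) (pt o) / d.
exists Om, f; split=> [i j|p q pq].
  have -> : \sum_o (f i o - f j o) ^+ 2 =
      t ^+ 2 / d ^+ 2 * \sum_o 16 * bump r (pt o) ^+ 2 * dotv (pt o) (y i - y j) ^+ 2.
    rewrite mulr_sumr; apply: eq_bigr => o _; rewrite /f /wave !dotvE.
    by field; rewrite gt_eqF.
  have -> : \sum_o 16 * bump r (pt o) ^+ 2 * dotv (pt o) (y i - y j) ^+ 2 =
      c * dotv (y i - y j) (y i - y j).
    exact: (@box_second_moment R n.+1 L
      (fun x => 16 * (Num.max 0 (r ^+ 2 - x)) ^+ 2) 0 (y i - y j)).
  rewrite d2 sqr_enorm.
  by field; rewrite !gt_eqF.
have [|||g [gi gy [s [s' [ss' s's gs]]]]] :=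
  @congruent_lattice_close R n k (fun a => t *: y (p a)) (fun a => t *: y (q a)).
- by move=> a; rewrite mxE y0 mulr0.
- by move=> a; rewrite mxE y0 mulr0.
- by move=> a b; rewrite -!scalerBr !enormZ pq.
have tyY j : enorm (t *: y j) <= t * Y.
  by rewrite enormZ gtr0_norm // ler_pM2l.
pose inbox (w : 'rV[int]_n.+1) := [forall i, (absz (w 0%R i) <= L)%N].
have inboxP w : ~~ inbox w -> 2 * r <= enorm (lattice R w).
  rewrite leNgt; apply: contra => small; apply/fintype.forallP => i.
  rewrite -(ler_nat R) LE; apply: le_trans (ltW small).
  apply: le_trans (normr_coord_le _ i).
  by rewrite mxE -intr_norm -abszE -pmulrn.
have inboxK w : inbox w -> box_point (@point_box n.+1 L w) = w.
  by move=> /fintype.forallP wL; apply: point_boxK.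
have inbox_pt (o : Om) : inbox (box_point o).
  by apply/fintype.forallP => i; apply: box_point_le.
(* Nothing happens near the faces of the box, where the bijection of the
   lattice may leave it: the waves vanish there. *)
have far w : 2 * r <= enorm (lattice R w) \/ 2 * r <= enorm (lattice R (s w)) ->
    forall a, wave r (t *: y (p a)) (lattice R w) = 0 /\
              wave r (t *: y (q a)) (lattice R (s w)) = 0.
  move=> far a.
  have e1 : enorm (g (lattice R w) - t *: y (q a)) =
            enorm (lattice R w - t *: y (p a)) by rewrite -gy gi.
  have e2 : _ <= C := gs w.
  have e3 := enorm_triangle (g (lattice R w)) (lattice R (s w)) (t *: y (q a)).
  have e4 := enorm_subr_ge (lattice R (s w)) (t *: y (q a)).
  have e5 := enorm_subr_ge (lattice R w) (t *: y (p a)).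
  have e6 := enorm_triangle (lattice R (s w)) (g (lattice R w)) (t *: y (q a)).
  have e6' := enormBC (g (lattice R w)) (lattice R (s w)).
  have e7 := enormD (lattice R (s w)) (- (t *: y (q a))).
  have e8 := enormD (lattice R w) (- (t *: y (p a))).
  move: e7 e8; rewrite !enormN => e7 e8.
  have e9 := tyY (p a); have e10 := tyY (q a).
  move: e1 e2 e3 e4 e5 e6 e6' e7 e8 e9 e10; clear -r0 rC far.
  by move=> *; split; apply: wave0 => //; case: far => ?; lra.
pose A := [set o : Om | inbox (s (box_point o))].
pose h (o : Om) : Om := point_box L (s (box_point o)).
have hE o : o \in A -> box_point (h o) = s (box_point o).
  by rewrite inE => /inboxK.
have [|pi piA] := @perm_extension Om A h.
  move=> o1 o2 /hE h1 /hE h2 /(congr1 (@box_point n.+1 L)).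
  by rewrite h1 h2 => /(can_inj ss') /(can_inj (@box_pointK _ _)).
exists pi => a.
pose E : R := 50 * r ^+ 2 * (t * Y) ^+ 2 + 6 * C * r ^+ 3.
have E0 : 0 <= E by rewrite addr_ge0 // mulr_ge0 ?exprn_ge0 // mulr_ge0 ?exprn_ge0.
have close o : `|wave r (t *: y (q a)) (pt (pi o)) -
                 wave r (t *: y (p a)) (pt o)| <= E.
  have [oA|oA] := boolP (o \in A).
    rewrite piA // /pt hE // -gy.
    apply: (@wave_intertwined _ _ r C (t * Y) g) => //; first by lra.
    - by lra.
    - by rewrite gy.
  have w1 : wave r (t *: y (p a)) (pt o) = 0.
    by apply: (far _ _ a).1; right; apply: inboxP; rewrite inE in oA.
  have w2 : wave r (t *: y (q a)) (pt (pi o)) = 0.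
    pose w := s' (box_point (pi o)).
    have sw : s w = box_point (pi o) by rewrite /w s's.
    rewrite /pt -sw; apply: (far _ _ a).2; left; apply: inboxP.
    apply/negP => wb; have wE := inboxK _ wb.
    have wA : point_box L w \in A by rewrite inE wE sw inbox_pt.
    have : pi (point_box L w) = pi o.
      by rewrite piA // /h wE sw box_pointK.
    by move/perm_inj => wo; move: oA; rewrite -wo wA.
  by rewrite w1 w2 subrr normr0.
apply: (@le_trans _ _ (\sum_(o : Om) E ^+ 2 / d ^+ 2)).
  apply: ler_sum => o _; rewrite /f -mulrBl exprMn exprVn ler_wpM2r //.
    by rewrite invr_ge0 sqr_ge0.
  by rewrite -[leLHS](real_normK (num_real _)) ler_pXn2r // nnegrE.
rewrite sumr_const card_mx card_ord mul1n -mulr_natl mulrA.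
rewrite ler_pdivrMr ?exprn_gt0 // d2.
exact: (box_error_bound (ltW eps0) rE cL Kr M0).
Qed.

(** * Concentration of measure for the Hamming distance *)

Section Spread.
Variable R : realFieldType.

(** Twice the variance of [h], multiplied by the square of the number of
   points. *)
Definition spread (T : finType) (h : T -> R) : R :=
  \sum_x \sum_y (h x - h y) ^+ 2.

Lemma spreadE (T : finType) (h : T -> R) :
  spread h = 2 * #|T|%:R * (\sum_x h x ^+ 2) - 2 * (\sum_x h x) ^+ 2.
Proof.
transitivity (\sum_s \sum_t (h s ^+ 2 + h t ^+ 2 - 2 * (h s * h t))).
  by apply: eq_bigr => s _; apply: eq_bigr => t _; ring.
under eq_bigr do
  rewrite big_split big_split /= sumr_const sumrN -mulr_sumr -mulr_sumr.
rewrite big_split big_split /= sumr_const sumrN -mulr_sumr -mulr_suml.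
rewrite sumrMnl -(mulr_natr (\sum_i h i ^+ 2)). ring.
Qed.

Lemma sum_sqr_le (T : finType) (h : T -> R) :
  (\sum_t h t) ^+ 2 <= #|T|%:R * \sum_t h t ^+ 2.
Proof.
have : 0 <= spread h.
  by apply: sumr_ge0 => s _; apply: sumr_ge0 => t _; apply: sqr_ge0.
by rewrite spreadE; lra.
Qed.

(** The variance on a product is the mean of the variances on one family of
   fibres plus the variance of the means, and Cauchy--Schwarz bounds the latter
   by the variances on the fibres in the other direction. *)
Lemma spread_prod (A B : finType) (h : A * B -> R) (al be : R) :
  (forall b, spread (fun a => h (a, b)) <= al * #|A|%:R ^+ 2) ->
  (forall a, spread (fun b => h (a, b)) <= be * #|B|%:R ^+ 2) ->
  spread h <= (al + be) * (#|A| * #|B|)%:R ^+ 2.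
Proof.
move=> hA hB; pose S b := \sum_a h (a, b).
have sumE (f : A * B -> R) : \sum_x f x = \sum_b \sum_a f (a, b).
  by rewrite exchange_big pair_bigA; apply: eq_bigr => -[].
have -> : spread h = #|B|%:R * (\sum_b spread (fun a => h (a, b))) + spread S.
  rewrite !spreadE (sumE h) (sumE (fun x => h x ^+ 2)) card_prod natrM.
  under [in RHS]eq_bigr do rewrite spreadE.
  rewrite sumrB -!mulr_sumr /S; ring.
have hS : spread S <= #|A|%:R * \sum_a spread (fun b => h (a, b)).
  have -> : \sum_a spread (fun b => h (a, b)) =
      \sum_b \sum_b' \sum_a (h (a, b) - h (a, b')) ^+ 2.
    rewrite exchange_big; apply: eq_bigr => b _; exact: exchange_big.
  rewrite mulr_sumr; apply: ler_sum => b _.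
  rewrite mulr_sumr; apply: ler_sum => b' _.
  by rewrite -sumrB sum_sqr_le.
have hA' : \sum_b spread (fun a => h (a, b)) <= #|B|%:R * (al * #|A|%:R ^+ 2).
  by rewrite mulr_natl -sumr_const; apply: ler_sum => b _.
have hB' : \sum_a spread (fun b => h (a, b)) <= #|A|%:R * (be * #|B|%:R ^+ 2).
  by rewrite mulr_natl -sumr_const; apply: ler_sum => a _.
rewrite natrM.
have := ler_wpM2l (ler0n R #|B|) hA'; have := ler_wpM2l (ler0n R #|A|) hB'.
by move: hS; lra.
Qed.

End Spread.

Section Hamming.
Variable X : finType.

Definition hamming M (x y : M.-tuple X) : nat :=
  \sum_(l < M) (tnth x l != tnth y l).

Lemma hammingC M (x y : M.-tuple X) : hamming x y = hamming y x.
Proof. by apply: eq_bigr => l _; rewrite eq_sym. Qed.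

Lemma hammingxx M (x : M.-tuple X) : hamming x x = 0%N.
Proof. by apply: big1 => l _; rewrite eqxx. Qed.

Lemma hamming_triangle M (y x z : M.-tuple X) :
  (hamming x z <= hamming x y + hamming y z)%N.
Proof.
rewrite -big_split; apply: leq_sum => l _.
have [-> /=|_] := eqVneq (tnth x l) (tnth y l); first by [].
by rewrite (leq_trans (leq_b1 _)) // leq_addr.
Qed.

Lemma hamming_cons M a b (x y : M.-tuple X) :
  hamming [tuple of a :: x] [tuple of b :: y] = ((a != b) + hamming x y)%N.
Proof.
rewrite /hamming big_ord_recl !tnth0; congr addn.
by apply: eq_bigr => l _; rewrite !tnthS.
Qed.

(** Each coordinate contributes at most one half to the variance. *)
Lemma hamming_lipschitz_spread (R : realFieldType) M (h : M.-tuple X -> R) :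
  (forall x y, `|h x - h y| <= (hamming x y)%:R) ->
  spread h <= M%:R * (#|X| ^ M)%:R ^+ 2.
Proof.
elim: M h => [|M IH] h hL.
  rewrite mul0r /spread big1 // => x _; rewrite big1 // => y _.
  by rewrite (tuple0 x) (tuple0 y) subrr expr2 mul0r.
pose cons (p : X * M.-tuple X) : M.+1.-tuple X := [tuple of p.1 :: p.2].
have consK : bijective cons.
  exists (fun t => (thead t, [tuple of behead t])).
    by case=> a t; rewrite /cons theadE; congr pair; apply/val_inj.
  by move=> t; rewrite [RHS]tuple_eta.
have -> : spread h = spread (h \o cons).
  rewrite /spread (reindex cons) /=; last exact: onW_bij.
  by apply: eq_bigr => p _; rewrite (reindex cons) //; apply: onW_bij.
have := @spread_prod R X (M.-tuple X) (h \o cons) 1 M%:R.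
rewrite card_tuple expnS -natr1 (addrC 1); apply => [b|a].
  rewrite mul1r /spread -natrX -[leRHS]mulr_natl mulr1 expnS expn1.
  rewrite [leRHS](_ : _ = \sum_(x : X) \sum_(y : X) 1); last first.
    by rewrite !sumr_const natrM mulr_natr.
  apply: ler_sum => x _; apply: ler_sum => y _.
  rewrite -real_normK ?num_real // exprn_ile1 //.
  apply: le_trans (hL _ _) _; rewrite hamming_cons hammingxx addn0.
  by rewrite (ler_nat R _ 1) leq_b1.
rewrite -card_tuple; apply: le_trans (IH _ _) _; last by rewrite card_tuple.
by move=> x y; apply: le_trans (hL _ _) _; rewrite hamming_cons eqxx.
Qed.

(** The distance to [A], truncated at [d], is [0] on [A] and [d] on [B], whereas
   its variance is at most [M] because it is Lipschitz. *)
Lemma hamming_concentration M d (A B : {set M.-tuple X}) :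
  {in A & B, forall x y, (d <= hamming x y)%N} ->
  (#|A| * #|B| * d ^ 2 <= M * (#|X| ^ M) ^ 2)%N.
Proof.
move=> AB.
pose h y : rat := \big[Num.min/d%:R]_(x in A) (hamming x y)%:R.
have hd y : h y <= d%:R by apply: bigmin_le_id.
have h_le y x : x \in A -> h y <= (hamming x y)%:R.
  by move=> xA; apply: (bigmin_inf x).
have hL x y : h x <= (hamming x y)%:R + h y.
  rewrite -lerBlDl; apply: le_bigmin => [|z zA].
    by rewrite lerBlDl (le_trans (hd _)) // lerDr ler0n.
  rewrite lerBlDl (le_trans (h_le _ _ zA)) // -natrD ler_nat addnC.
  by rewrite (hammingC x y) hamming_triangle.
have h0 x : x \in A -> h x = 0.
  move=> xA; apply/eqP; rewrite eq_le; apply/andP; split.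
    by have := h_le x x xA; rewrite hammingxx.
  by apply: le_bigmin => // z _.
have hB y : y \in B -> h y = d%:R.
  move=> yB; apply/eqP; rewrite eq_le hd /=; apply: le_bigmin => // z zA.
  by rewrite ler_nat AB.
have /(hamming_lipschitz_spread (R := rat)) hs x y : `|h x - h y| <= (hamming x y)%:R.
  rewrite ler_norml lerBlDr hL andbT.
  by have := hL y x; rewrite hammingC; lra.
rewrite -(ler_nat rat) 2!natrM [leRHS]natrM [in leRHS]natrX natrX.
apply: le_trans hs.
have -> : #|A|%:R * #|B|%:R * d%:R ^+ 2 =
    \sum_(x in A) \sum_(y in B) (h x - h y) ^+ 2.
  rewrite -mulrA mulr_natl -sumr_const; apply: eq_bigr => x xA.
  rewrite mulr_natl -sumr_const; apply: eq_bigr => y yB.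
  by rewrite h0 // hB // sub0r sqrrN.
rewrite /spread [leRHS](bigID (mem A)) /= -[leLHS]addr0; apply: lerD.
  apply: ler_sum => x _; rewrite [leRHS](bigID (mem B)) /= lerDl.
  by apply: sumr_ge0 => y _; apply: sqr_ge0.
by apply: sumr_ge0 => x _; apply: sumr_ge0 => y _; apply: sqr_ge0.
Qed.

(** One of the colour classes has density at least [1 / c], so that all points
   outside a set of density less than [1 / N] are close to it; the preimages of
   this exceptional set under [N] bijections do not cover the whole power. *)
Lemma hamming_colouring c N q (x0 : X) : (0 < q)%N ->
  exists2 M, (0 < M)%N & forall (col : M.-tuple X -> 'I_c)
      (tr : 'I_N -> M.-tuple X -> M.-tuple X), (forall t, injective (tr t)) ->
    exists th kap, forall t, exists th',
      col th' = kap /\ (hamming (tr t th) th' * q <= M)%N.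
Proof.
move=> q0; pose M' := (c * N * q).+1; exists (M' * q)%N; first by rewrite muln_gt0.
move=> col tr tr_inj; set M := (M' * q)%N; set P := (#|X| ^ M)%N.
have P0 : (0 < P)%N by rewrite expn_gt0; apply/orP; left; apply/card_gt0P; exists x0.
have cardP : #|{: M.-tuple X}| = P by rewrite card_tuple.
pose A kap := [set th | col th == kap].
have [kap Akap] : exists kap, (P <= c * #|A kap|)%N.
  apply/fintype.existsP; apply: contraT; rewrite negb_exists => /fintype.forallP small.
  suff : (c * P < c * P)%N by rewrite ltnn.
  have c0 : (0 < c)%N by case: (c) (col [tuple of nseq M x0]) => [[]|].
  rewrite -{1}cardP -sum1_card (partition_big col xpredT) //= big_distrr /=.
  apply: (@leq_trans (\sum_(i < c) P)); last by rewrite sum_nat_const card_ord.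
  have lt1 i : (c * \sum_(th | col th == i) 1 < P)%N.
    rewrite sum1_card ltnNge; apply: contra (small i).
    by rewrite (eq_card (B := A i)) // => th; rewrite !inE.
  rewrite (bigD1 (Ordinal c0)) // [leqRHS](bigD1 (Ordinal c0)) //= -addSn.
  by apply: leq_add; rewrite ?lt1 //; apply: leq_sum => i _; apply: ltnW.
pose B := [set y | [forall x in A kap, (M' <= hamming x y)%N]].
have AB : {in A kap & B, forall x y, (M' <= hamming x y)%N}.
  by move=> x y xA; rewrite inE => /forall_inP; apply.
have BP : (N * #|B| < P)%N.
  have := hamming_concentration AB; rewrite -/P => conc.
  rewrite ltnNge; apply/negP => NB.
  have : (P * P * M' ^ 2 <= c * N * (M' * q) * (P * P))%N.
    apply: (@leq_trans (c * #|A kap| * (N * #|B|) * M' ^ 2)).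
      by rewrite leq_mul2r leq_mul ?orbT.
    move: conc; rewrite -/M.
    have -> : (c * #|A kap| * (N * #|B|) * M' ^ 2 =
               c * N * (#|A kap| * #|B| * M' ^ 2))%N by nia.
    by move=> conc; rewrite -[leqRHS]mulnA leq_mul2l conc orbT.
  suff : (c * N * (M' * q) < M' ^ 2)%N by nia.
  by rewrite /M'; nia.
have [th thB] : exists th, forall t, tr t th \notin B.
  suff : [exists th, [forall t, tr t th \notin B]].
    by case/fintype.existsP => th /fintype.forallP; exists th.
  apply: contraLR BP; rewrite negb_exists => /fintype.forallP cover; rewrite -leqNgt.
  have -> : P = (\sum_(th : M.-tuple X) 1)%N by rewrite -cardP -sum1_card.
  apply: (@leq_trans (\sum_th \sum_(t < N) (tr t th \in B))).
    apply: leq_sum => th _; have := cover th; rewrite negb_forall.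
    case/fintype.existsP => t; rewrite negbK => tB.
    by rewrite (bigD1 t) //= tB leq_addr.
  rewrite exchange_big /=; apply: (@leq_trans (\sum_(t < N) #|B|)); last first.
    by rewrite sum_nat_const card_ord.
  apply: leq_sum => t _; rewrite -sum1_card [leqRHS]big_mkcond /=.
  by rewrite [leqRHS](reindex_inj (tr_inj t)); apply: leq_sum => th _; case: ifP.
exists th, kap => t.
have := thB t; rewrite inE negb_forall_in => /exists_inP[th' th'A].
rewrite -ltnNge => /ltnW h.
exists th'; split; first by move: th'A; rewrite inE => /eqP.
by rewrite hammingC /M leq_mul2r h orbT.
Qed.

End Hamming.

(** * The Ramsey property in Euclidean space *)

Section PermutedCopies.
Variables (R : realType) (Om : finType) (M : nat).
Hypothesis M_gt0 : (0 < M)%N.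
Implicit Types (th : M.-tuple {perm Om}) (u v : Om -> R).

(** Dividing by the square root of [M] makes the [M] copies of [u], each moved by
   its own permutation, as large together as [u] alone. *)
Definition permuted th u (ol : Om * 'I_M) : R :=
  u (tnth th ol.2 ol.1) / Num.sqrt M%:R.

Let sqrM : Num.sqrt M%:R ^+ 2 = M%:R :> R.
Proof. by rewrite sqr_sqrtr. Qed.

Let sqrM0 : Num.sqrt M%:R != 0 :> R.
Proof. by rewrite gt_eqF // sqrtr_gt0 ltr0n. Qed.

Let M0 : M%:R != 0 :> R. Proof. by rewrite gt_eqF // ltr0n. Qed.

Lemma sum_permuted th th' u v :
  \sum_ol (permuted th u ol - permuted th' v ol) ^+ 2 =
  (\sum_l \sum_o (u (tnth th l o) - v (tnth th' l o)) ^+ 2) / M%:R.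
Proof.
transitivity (\sum_o \sum_l (permuted th u (o, l) - permuted th' v (o, l)) ^+ 2).
  by rewrite pair_bigA; apply: eq_bigr => -[].
rewrite exchange_big mulr_suml; apply: eq_bigr => l _.
rewrite mulr_suml; apply: eq_bigr => o _.
by rewrite /permuted /= -mulrBl exprMn exprVn sqrM.
Qed.

Lemma permuted_isometry th u v :
  \sum_ol (permuted th u ol - permuted th v ol) ^+ 2 = \sum_o (u o - v o) ^+ 2.
Proof.
rewrite sum_permuted (eq_bigr (fun=> \sum_o (u o - v o) ^+ 2)); last first.
  by move=> l _; rewrite [RHS](reindex_inj (@perm_inj _ (tnth th l))).
by rewrite sumr_const card_ord -[X in X / _]mulr_natr mulfK.
Qed.

Lemma permuted_translate th (s : {perm Om}) u v :
  \sum_ol (permuted th u ol -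
           permuted [tuple of map (fun t => t * s^-1)%g th] v ol) ^+ 2 =
  \sum_o (u (s o) - v o) ^+ 2.
Proof.
rewrite sum_permuted (eq_bigr (fun=> \sum_o (u (s o) - v o) ^+ 2)).
  by rewrite sumr_const card_ord -[X in X / _]mulr_natr mulfK.
move=> l _; rewrite [RHS](reindex_inj (@perm_inj _ (tnth th l * s^-1)%g)).
by apply: eq_bigr => o _; rewrite tnth_map permM permKV.
Qed.

(** A copy contributes to the distance only where the permutations differ. *)
Lemma permuted_hamming th th' u :
  \sum_ol (permuted th u ol - permuted th' u ol) ^+ 2 <=
  (hamming th th')%:R / M%:R * (4 * \sum_o u o ^+ 2).
Proof.
rewrite sum_permuted mulrAC ler_wpM2r ?invr_ge0 //.
rewrite /hamming natr_sum mulr_suml; apply: ler_sum => l _.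
have [->|_] := eqVneq (tnth th l) (tnth th' l).
  by rewrite mul0r big1 // => o _; rewrite subrr expr2 mul0r.
rewrite mul1r.
apply: (@le_trans _ _ (\sum_o (2 * u (tnth th l o) ^+ 2 +
                               2 * u (tnth th' l o) ^+ 2))).
  by apply: ler_sum => o _; have := sqr_ge0 (u (tnth th l o) + u (tnth th' l o)); lra.
rewrite big_split /= -!mulr_sumr.
have e (t : {perm Om}) : \sum_o u (t o) ^+ 2 = \sum_o u o ^+ 2.
  by rewrite [RHS](reindex_inj (@perm_inj _ t)).
by rewrite !e; lra.
Qed.

End PermutedCopies.

(** The tuple [z] arises from [p0] by an element of the power that has colour
   [kap] and is near the product of [th] with the inverse of a permutation that
   matches the tuple [p] with the tuple [p0]. *)
Lemma euclidean_ramsey (R : realType) n m k c (y : 'I_m -> 'rV[R]_n.+1)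
    (p0 : 'I_k -> 'I_m) (eps : R) :
  0 < eps -> (forall j, y j 0 ord_max = 0) ->
  exists L : finType, forall col : ('I_k -> L -> R) -> 'I_c,
  exists (Psi : 'I_m -> L -> R) (kap : 'I_c),
    (forall i j, \sum_l (Psi i l - Psi j l) ^+ 2 = enorm (y i - y j) ^+ 2) /\
    forall p : 'I_k -> 'I_m,
      (forall a b, enorm (y (p0 a) - y (p0 b)) = enorm (y (p a) - y (p b))) ->
      exists z : 'I_k -> L -> R,
        [/\ col z = kap,
            forall a b, \sum_l (z a l - z b l) ^+ 2 =
                        enorm (y (p0 a) - y (p0 b)) ^+ 2 &
            forall a, \sum_l (Psi (p a) l - z a l) ^+ 2 <= eps].
Proof.
move=> eps0 y0.
have eps4 : 0 < eps / 4 by rewrite divr_gt0.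
have [Om [f [fy fp]]] := permutation_model k eps4 y0.
have /choice[s sP] : forall p : {ffun 'I_k -> 'I_m}, exists s : {perm Om},
    (forall a b, enorm (y (p0 a) - y (p0 b)) = enorm (y (p a) - y (p b))) ->
    forall a, \sum_o (f (p a) (s o) - f (p0 a) o) ^+ 2 <= eps / 4.
  move=> p; have [/fp[s sP]|np] := pselect (forall a b,
    enorm (y (p0 a) - y (p0 b)) = enorm (y (p a) - y (p b))); first by exists s.
  by exists 1%g.
(* The size of the model is known only after its precision [eps / 4] has been
   chosen, and it governs the fraction [1 / q] of coordinates that may differ. *)
pose B : R := \sum_j \sum_o f j o ^+ 2.
have fB j : \sum_o f j o ^+ 2 <= B.
  rewrite /B (bigD1 j) //= lerDl; apply: sumr_ge0 => i _.
  by apply: sumr_ge0 => o _; apply: sqr_ge0.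
have B0 : 0 <= B by apply: sumr_ge0 => j _; apply: sumr_ge0 => o _; apply: sqr_ge0.
pose q := (Num.truncn (16 * B / eps)).+1.
have qB : 16 * B <= eps * q%:R.
  by rewrite [leRHS]mulrC -ler_pdivrMr // ltW // truncnS_gt.
have [M M0 HM] := @hamming_colouring {perm Om} c #|{ffun 'I_k -> 'I_m}| q 1%g isT.
have Mp : 0 < M%:R :> R by rewrite ltr0n.
exists (Om * 'I_M)%type => col.
pose tr (t : 'I_#|{ffun 'I_k -> 'I_m}|) (th : M.-tuple {perm Om}) :=
  [tuple of map (fun g => g * (s (enum_val t))^-1)%g th].
have [|th [kap Hth]] := HM (fun th => col (fun a => permuted th (f (p0 a)))) tr.
  move=> t th1 th2 /(congr1 val) /= /inj_map e; apply/val_inj/e.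
  exact: mulIg.
exists (fun j => permuted th (f j)), kap; split=> [i j|p pp].
  by rewrite permuted_isometry // fy.
pose pf := [ffun a => p a].
have [th' [colth' hth']] := Hth (enum_rank pf).
exists (fun a => permuted th' (f (p0 a))); split=> // [a b|a].
  by rewrite permuted_isometry // fy.
set th1 := tr _ th in hth'.
have h1 : \sum_ol (permuted th (f (p a)) ol - permuted th1 (f (p0 a)) ol) ^+ 2
    <= eps / 4.
  rewrite /th1 /tr enum_rankK permuted_translate //.
  have := sP pf _ a; rewrite ffunE; apply => a1 b1; rewrite !ffunE; exact: pp.
have h2 : \sum_ol (permuted th1 (f (p0 a)) ol - permuted th' (f (p0 a)) ol) ^+ 2
    <= eps / 4.
  apply: le_trans (permuted_hamming _ _ _) _.
  rewrite mulrAC ler_pdivrMr //.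
  have hq : (hamming th1 th')%:R * q%:R <= M%:R :> R by rewrite -natrM ler_nat.
  have h0 : 0 <= (hamming th1 th')%:R :> R by [].
  have := ler_wpM2l h0 (fB (p0 a)); have := ler_wpM2l h0 qB.
  have := ler_wpM2l (ltW eps0) hq.
  lra.
apply: (@le_trans _ _ (\sum_ol
  (2 * (permuted th (f (p a)) ol - permuted th1 (f (p0 a)) ol) ^+ 2 +
   2 * (permuted th1 (f (p0 a)) ol - permuted th' (f (p0 a)) ol) ^+ 2))).
  apply: ler_sum => ol _.
  set u := permuted th _ _; set v := permuted th1 _ _; set w := permuted th' _ _.
  by have := sqr_ge0 (u - v - (v - w)); lra.
by rewrite big_split /= -!mulr_sumr; lra.
Qed.

(** * Euclidean spaces and infinite-dimensional Hilbert spaces *)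

Local Open Scope classical_set_scope.

Section GramSchmidt.
Variables (K : numFieldType) (conj : K -> K) (H : normedModType K).
Variable dot : {dot H for conj}.
Hypothesis conj_norm : forall a, a * conj a = `|a| ^+ 2.
Hypothesis dot_norm : forall x, dot x x = `|x| ^+ 2.
Implicit Types (x y : H) (e : nat -> H) (n : nat).

Let dotC x y : dot x y = conj (dot y x).
Proof.
have := @hermitian_subproof _ _ false conj dot x y.
by rewrite expr0 mul1r.
Qed.

Definition orthonormal n e : Prop :=
  forall i j, (i < n)%N -> (j < n)%N -> dot (e i) (e j) = (i == j)%:R.

Definition spans n e x : Prop := exists a : nat -> K, x = \sum_(k < n) a k *: e k.

Lemma orthonormal_norm n e (a : nat -> K) : orthonormal n e ->
  `|\sum_(k < n) a k *: e k| ^+ 2 = \sum_(k < n) `|a k| ^+ 2.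
Proof.
move=> one; rewrite -dot_norm linear_sumlz; apply: eq_bigr => i _.
rewrite linearZl_LR linear_sumr (bigD1 i) //= big1 => [|j ji].
  by rewrite linearZr_LR /= one // eqxx mulr1 addr0 conj_norm.
rewrite linearZr_LR /= one //.
by rewrite (inj_eq val_inj) eq_sym (negPf ji) mulr0.
Qed.

(** One step of the Gram--Schmidt process. *)
Lemma orthonormal_extend n e x : orthonormal n e ->
  spans n e x \/ exists e', [/\ orthonormal n.+1 e',
    forall y, spans n e y -> spans n.+1 e' y & spans n.+1 e' x].
Proof.
move=> one; pose r := x - \sum_(k < n) dot x (e k) *: e k.
have re j : (j < n)%N -> dot r (e j) = 0.
  move=> jn; rewrite linearBl linear_sumlz (bigD1 (Ordinal jn)) //= big1.
    by rewrite linearZl_LR /= one // eqxx mulr1 addr0 subrr.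
  move=> k kj; rewrite linearZl_LR /= one //.
  by rewrite -(inj_eq val_inj) /= in kj; rewrite (negPf kj) mulr0.
have er j : (j < n)%N -> dot (e j) r = 0.
  move=> jn; rewrite linearBr linear_sumr (bigD1 (Ordinal jn)) //= big1.
    by rewrite linearZr_LR /= one // eqxx mulr1 addr0 -dotC subrr.
  move=> k kj; rewrite linearZr_LR /= one //.
  by rewrite -(inj_eq val_inj) /= eq_sym in kj; rewrite (negPf kj) mulr0.
have xE : x = \sum_(k < n) dot x (e k) *: e k + r by rewrite addrC subrK.
have [r0|r0] := eqVneq r 0.
  by left; exists (fun k => dot x (e k)); rewrite {1}xE r0 addr0.
right; pose c := `|r|^-1; have r0' : `|r| != 0 by rewrite normr_eq0.
exists (fun k => if k == n then c *: r else e k); split.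
- move=> i j; rewrite !ltnS (leq_eqVlt i) (leq_eqVlt j).
  have lt_ne k : (k < n)%N -> (k == n) = false by move=> kn; rewrite ltn_eqF.
  case/predU1P=> [->|i_n]; case/predU1P=> [->|j_n]; rewrite ?eqxx ?(lt_ne _ i_n) ?(lt_ne _ j_n).
  + rewrite linearZl_LR linearZr_LR /= mulrA conj_norm dot_norm /c normfV normr_id.
    by rewrite -exprMn mulVf // expr1n.
  + by rewrite linearZl_LR /= re // mulr0 eq_sym (lt_ne _ j_n).
  + by rewrite linearZr_LR /= er // mulr0.
  + exact: one.
- move=> y [a ->]; exists (fun k => if k == n then 0 else a k).
  rewrite big_ord_recr /= eqxx scale0r addr0; apply: eq_bigr => k _.
  by rewrite ltn_eqF.
- exists (fun k => if k == n then `|r| else dot x (e k)).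
  rewrite {1}xE big_ord_recr /= eqxx scalerA divff // scale1r; congr (_ + _).
  by apply: eq_bigr => k _; rewrite ltn_eqF.
Qed.

Lemma orthonormal_exists n : ~ finite_dimensional H -> exists e, orthonormal n e.
Proof.
move=> hinf; elim: n => [|n [e one]]; first by exists (fun=> 0).
apply: contrapT => none; apply: hinf; exists n, (fun k => e k) => x.
have [[a xE]|[e' [one' _ _]]] := orthonormal_extend x one.
  by exists (fun k => a k).
by case: none; exists e'.
Qed.

Lemma orthonormal_spanning m (g : nat -> H) :
  exists n e, orthonormal n e /\ forall j, (j < m)%N -> spans n e (g j).
Proof.
elim: m => [|m [n [e [one eg]]]]; first by exists 0%N, (fun=> 0).
have [gm|[e' [one' ee' gm]]] := orthonormal_extend (g m) one.
  by exists n, e; split=> // j; rewrite ltnS leq_eqVlt => /predU1P[->|/eg].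
exists n.+1, e'; split=> // j.
by rewrite ltnS leq_eqVlt => /predU1P[->|/eg /ee'].
Qed.

End GramSchmidt.

(** What the real and the complex scalars have in common; for the real ones,
   [im] is zero. *)
Definition real_coordinates (R : realType) (K : numFieldType)
    (iota : {rmorphism R -> K}) (re im : K -> R) : Prop :=
  [/\ {mono iota : a b / a <= b},
      forall a, 0 <= a -> iota (re a) = a &
      forall a b, `|a - b| ^+ 2 = iota ((re a - re b) ^+ 2 + (im a - im b) ^+ 2)].

Section RealCoordinates.
Variables (R : realType) (K : numFieldType) (iota : {rmorphism R -> K}).
Variables (re im : K -> R).
Hypothesis coord : real_coordinates iota re im.

Let iota_mono : {mono iota : a b / a <= b}. Proof. by case: coord. Qed.
Let iota_re a : 0 <= a -> iota (re a) = a. Proof. by case: coord => _ + _; apply. Qed.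
Let iota_norm a b :
  `|a - b| ^+ 2 = iota ((re a - re b) ^+ 2 + (im a - im b) ^+ 2).
Proof. by case: coord. Qed.

Let iota_inj : injective iota.
Proof.
by move=> a b ab; apply/eqP; rewrite eq_le -!iota_mono ab lexx.
Qed.

Lemma iota_ge0 a : (0 <= iota a) = (0 <= a).
Proof. by rewrite -(rmorph0 iota) iota_mono. Qed.

Lemma iota_lt a b : (iota a < iota b) = (a < b).
Proof. by rewrite !lt_neqAle iota_mono (inj_eq iota_inj). Qed.

Lemma iota_sqr_norm a : `|iota a| ^+ 2 = iota (a ^+ 2).
Proof.
rewrite rmorphXn real_normK // realE -(rmorph0 iota) !iota_mono.
exact: le_total.
Qed.

Variable H : normedModType K.
Variables (conj : K -> K) (dot : {dot H for conj}).
Hypothesis conj_norm : forall a, a * conj a = `|a| ^+ 2.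
Hypothesis dot_norm : forall x, dot x x = `|x| ^+ 2.

Definition rnorm (x : H) : R := re `|x|.

Lemma iota_rnorm x : iota (rnorm x) = `|x|.
Proof. exact: iota_re. Qed.

Lemma rnorm_ge0 x : 0 <= rnorm x.
Proof. by rewrite -iota_ge0 iota_rnorm. Qed.

Lemma rnorm_sqr (x : H) a : `|x| ^+ 2 = iota a -> rnorm x ^+ 2 = a.
Proof. by move=> xa; apply: iota_inj; rewrite rmorphXn /= iota_rnorm. Qed.

Lemma euclidean_isometry (L : finType) : ~ finite_dimensional H ->
  exists T : (L -> R) -> H,
    forall u v, rnorm (T u - T v) ^+ 2 = \sum_l (u l - v l) ^+ 2.
Proof.
move=> hinf.
have [e one] := orthonormal_exists conj_norm dot_norm #|L| hinf.
pose c (u : L -> R) (k : nat) : R := oapp u 0 (onth (enum L) k).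
exists (fun u => \sum_(k < #|L|) iota (c u k) *: e k) => u v.
apply: rnorm_sqr; rewrite -sumrB.
under eq_bigr do rewrite -scalerBl -rmorphB.
rewrite (orthonormal_norm conj_norm dot_norm (fun k => iota (c u k - c v k))) //.
rewrite (reindex_onto enum_rank enum_val) /=; last by move=> k _; rewrite enum_valK.
rewrite rmorph_sum; apply: eq_big => [l|l _]; first by rewrite enum_rankK eqxx.
rewrite iota_sqr_norm /c.
have -> : onth (enum L) (enum_rank l) = Some l.
  by rewrite onthE (nth_map l) ?nth_enum_rank // -cardE ltn_ord.
by [].
Qed.

(** The coordinates of the points in an orthonormal basis of their span have
   real and imaginary parts, whence the doubled dimension; the last coordinate
   is kept free for the half turns. *)
Lemma euclidean_coordinates m (g : 'I_m -> H) :
  exists n (y : 'I_m -> 'rV[R]_n.+1),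
    (forall j, y j 0 ord_max = 0) /\
    forall i j, enorm (y i - y j) = rnorm (g i - g j).
Proof.
have [n [e [one eg]]] :=
  orthonormal_spanning conj_norm dot_norm m (fun j => oapp g 0 (insub j)).
have /choice[a ga] : forall j : 'I_m, exists a : nat -> K,
    g j = \sum_(k < n) a k *: e k.
  by move=> j; have [a] := eg j (ltn_ord j); rewrite valK /= => ?; exists a.
pose co j (l : 'I_(n + n)) : R :=
  match fintype.split l with inl k => re (a j k) | inr k => im (a j k) end.
pose y j : 'rV[R]_(n + n).+1 := \row_l oapp (co j) 0 (unlift ord_max l).
exists (n + n)%N, y; split=> [j|i j]; first by rewrite mxE unlift_none.
apply/eqP; rewrite -(@eqrXn2 _ 2) ?enorm_ge0 ?rnorm_ge0 //; apply/eqP.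
apply/esym/rnorm_sqr; rewrite !ga -sumrB.
under eq_bigr do rewrite -scalerBl.
rewrite (orthonormal_norm conj_norm dot_norm (fun k => a i k - a j k)) //.
under eq_bigr do rewrite iota_norm.
rewrite -rmorph_sum sqr_enorm /dotv; congr (iota _).
rewrite (bigD1_ord ord_max) //= !mxE unlift_none subrr mul0r add0r.
rewrite big_split_ord /= -big_split; apply: eq_bigr => k _.
by rewrite !mxE !liftK /= /co !(unsplitK (inl k)) !(unsplitK (inr k)) -!expr2.
Qed.

End RealCoordinates.

(** * Colourings of the copies of a finite subspace *)

Section Copies.
Variables (K : numFieldType) (H : normedModType K).
Implicit Types (F G : set H) (i j : H -> H).

Lemma finite_set_family (T : eqType) (A : set T) : finite_set A ->
  exists k (f : 'I_k -> T), range f = A.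
Proof.
case/finite_seqP => s ->; exists (size s), (fun a => tnth (in_tuple s) a).
apply/seteqP; split => [_ [a _ <-] /=|x /= xs]; first exact: mem_tnth.
by have /tnthP[a ->] : x \in in_tuple s by []; exists a.
Qed.

(** Points of [f] that coincide have images that coincide, so the
   correspondence between the families is a function. *)
Lemma family_copy k (f h : 'I_k -> H) :
  (forall a b, `|h a - h b| = `|f a - f b|) ->
  exists i, [/\ isometric_embedding (range f) i, i @` range f = range h &
                forall a, i (f a) = h a].
Proof.
move=> hf.
have /choice[i fi] : forall x, exists z, forall a, f a = x -> z = h a.
  move=> x; have [[a <-]|none] := pselect (exists a, f a = x); last first.
    by exists 0 => a fa; case: none; exists a.
  exists (h a) => b ba; apply/eqP; rewrite -subr_eq0 -normr_eq0 hf.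
  by rewrite ba subrr normr0.
have {}fi a : i (f a) = h a by apply: fi.
exists i; split=> //.
  by move=> _ _ [a _ <-] [b _ <-]; rewrite !fi hf.
apply/seteqP; split => [_ [_ [a _ <-] <-]|_ [a _ <-]].
  by rewrite fi; exists a.
by exists (f a); rewrite ?fi //; exists a.
Qed.

Lemma dsup_ge0 F i j : 0 <= dsup F i j.
Proof.
rewrite /dsup; elim/big_ind: _ => // x y x0 y0.
by rewrite maxEle; case: ifP.
Qed.

Lemma dsup_le F i j r : finite_set F -> 0 <= r ->
  (forall x, F x -> `|i x - j x| <= r) -> dsup F i j <= r.
Proof.
move=> finF r0 Fr; rewrite /dsup big_seq.
elim/big_ind: _ => // [x y xr yr|x]; first by rewrite maxEle; case: ifP.
by rewrite in_fset_set // => /set_mem /Fr.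
Qed.

(** The order of the scalars may be partial, but it is total on nonnegative
   elements. *)
Lemma nonneg_seq_min (s : seq K) : s != [::] -> (forall x, x \in s -> 0 <= x) ->
  exists2 d, d \in s & forall x, x \in s -> d <= x.
Proof.
elim: s => // x [|y s] IH _ s0.
  by exists x; rewrite ?mem_head // => z; rewrite inE => /eqP->.
have [||d ds dmin] := IH; first by [].
  by move=> z zs; apply: s0; rewrite inE zs orbT.
have : x >=< d.
  by apply: real_comparable; apply: ger0_real; apply: s0; rewrite ?mem_head // inE ds orbT.
case/orP => [xd|dx].
  exists x; rewrite ?mem_head // => z; rewrite inE => /predU1P[->//|/dmin].
  exact: le_trans.
exists d => [|z]; first by rewrite inE ds orbT.
rewrite inE => /predU1P[->//|].
exact: dmin.
Qed.

(** The values of [dsup] are zero or distances between a point of one copy and a point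
   of the other one, so there are finitely many of them. *)
Lemma copy_distance_exists F F1 F2 : finite_set F ->
  isometric_copies F F1 -> isometric_copies F F2 ->
  exists d, copy_distance F F1 F2 d.
Proof.
move=> finF [i0 i0e i0F] [j0 j0e j0F].
have fin1 : finite_set F1 by rewrite -i0F; apply: finite_image.
have fin2 : finite_set F2 by rewrite -j0F; apply: finite_image.
have sub : dsup_values F F1 F2 `<=`
    [set 0] `|` (fun p : H * H => `|p.1 - p.2|) @` (F1 `*` F2).
  move=> _ [i [j [[ie iF] [je jF] ->]]]; rewrite /dsup big_seq.
  elim/big_ind: _ => [|x y xA yA|x]; first by left.
    by rewrite maxEle; case: ifP.
  rewrite in_fset_set // => /set_mem Fx; right; exists (i x, j x) => //.
  by split; rewrite /= -?iF -?jF; exists x.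
have : finite_set (dsup_values F F1 F2).
  apply: sub_finite_set sub _; rewrite finite_setU; split; first exact: finite_set1.
  by apply: finite_image; apply: finite_setX.
case/finite_seqP => s sE.
have mems x : (x \in s) = `[< dsup_values F F1 F2 x >].
  by rewrite sE; apply/idP/asboolP.
have [||d ds dmin] := @nonneg_seq_min s.
- have : dsup F i0 j0 \in s by rewrite mems; apply/asboolP; exists i0, j0.
  by case: (s).
- by move=> x; rewrite mems => /asboolP[i [j [_ _ ->]]]; apply: dsup_ge0.
exists d; split; first by apply/asboolP; rewrite -mems.
by move=> x vx; apply: dmin; rewrite mems; apply/asboolP.
Qed.

End Copies.

Section Assembly.
Variables (R : realType) (K : numFieldType) (iota : {rmorphism R -> K}).
Variables (re im : K -> R) (coord : real_coordinates iota re im).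
Variables (H : normedModType K) (conj : K -> K) (dot : {dot H for conj}).
Hypothesis conj_norm : forall a, a * conj a = `|a| ^+ 2.
Hypothesis dot_norm : forall x, dot x x = `|x| ^+ 2.
Let rn := @rnorm R K re H.

Let norm_rn (x y : H) : (`|x| = `|y|) <-> (rn x = rn y).
Proof.
split=> [|e]; first by rewrite /rn /rnorm => ->.
by rewrite -!(iota_rnorm coord) -/rn e.
Qed.

Lemma monochromatic_copy (F G : set H) (gamma : set (set (set H))) (eps : K) :
  ~ finite_dimensional H -> finite_set F -> finite_colouring F gamma ->
  finite_set G -> 0 < eps ->
  exists2 G' : set H, isometric_copies G G' &
    monochromatic_upto F gamma eps
      [set F' : set H | F' `<=` G' /\ isometric_copies F F'].
Proof.
move=> hinf finF [fing [gcov _ _]] finG eps0.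
(* The sets are listed by families indexed by ordinals, repetitions being
   harmless. *)
have [k [f fF]] := finite_set_family finF.
have [m [g gG]] := finite_set_family finG.
have [c [A gA]] := finite_set_family fing.
have colour F' : isometric_copies F F' -> exists kap, A kap F'.
  rewrite -gcov => -[A' + A'F]; rewrite -gA => -[kap _ kapA].
  by exists kap; rewrite kapA.
have [kap0 _] : exists kap, A kap F.
  by apply: colour; exists id; rewrite ?image_id.
have gammaA kap : gamma (A kap) by rewrite -gA; exists kap.
have subfamily (h : 'I_m -> H) F' : F' `<=` range h -> isometric_copies F F' ->
    (forall a b, rn (h a - h b) = rn (g a - g b)) ->
    exists i (p : 'I_k -> 'I_m), [/\ isometric_embedding F i, i @` F = F',
      forall a, i (f a) = h (p a) &
      forall a b, rn (f a - f b) = rn (g (p a) - g (p b))].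
  move=> F'h [i ie iF] hg.
  have /choice[p ip] : forall a, exists b, i (f a) = h b.
    move=> a; have [|b _ hb] := F'h (i (f a)); last by exists b.
    by rewrite -iF -fF; exists (f a) => //; exists a.
  exists i, p; split=> // a b; rewrite -hg -!ip; apply/norm_rn.
  by rewrite ie // -fF; [exists a | exists b].
have [[p0 p0P]|none] := pselect (exists p0 : 'I_k -> 'I_m,
    forall a b, rn (f a - f b) = rn (g (p0 a) - g (p0 b))); last first.
  exists G; first by exists id; rewrite ?image_id.
  exists (A kap0) => // F' [F'G F'c]; case: none.
  by have [||//|i [p [_ _ _ pP]]] := subfamily g F'; [rewrite gG | | exists p].
have [n [y [y0 yg]]] := euclidean_coordinates coord conj_norm dot_norm g.
pose e := re eps.
have eE : iota e = eps by case: coord => _ + _; apply; apply: ltW.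
have e0 : 0 < e by rewrite -(iota_lt coord) eE rmorph0.
have e2 : 0 < (e / 2) ^+ 2 by rewrite exprn_gt0 // divr_gt0.
have [L ramsey] := euclidean_ramsey c p0 e2 y0.
have [T TI] := euclidean_isometry coord conj_norm dot_norm L hinf.
(* Tuples that do not make up a copy of [F] get the default colour [kap0]. *)
pose col (z : 'I_k -> L -> R) : 'I_c :=
  odflt kap0 [pick kap | `[< A kap (range (fun a => T (z a))) >]].
have [Psi [kap [Psi_y mono]]] := ramsey col.
pose h j := T (Psi j).
have rn_eq (x x' : H) : rn x ^+ 2 = rn x' ^+ 2 -> rn x = rn x'.
  by move/eqP; rewrite eqrXn2 ?(rnorm_ge0 coord) // => /eqP.
have hg a b : rn (h a - h b) = rn (g a - g b).
  by apply: rn_eq; rewrite TI Psi_y yg.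
exists (range h).
  have [|i [ie ih _]] := @family_copy _ _ _ g h.
    by move=> a b; apply/norm_rn/hg.
  by rewrite -gG; exists i.
exists (A kap) => // F' [F'h F'c].
have [i [p [ie iF ip pP]]] := subfamily h F' F'h F'c hg.
have [|z [colz z_iso z_close]] := mono p.
  by move=> a b; rewrite !yg -/rn -p0P -pP.
have [|j [je jz jf]] := @family_copy _ _ _ f (fun a => T (z a)).
  by move=> a b; apply/norm_rn/rn_eq; rewrite TI z_iso yg p0P.
rewrite fF in je jz.
have zc : isometric_copies F (range (fun a => T (z a))) by exists j.
have Az : A kap (range (fun a => T (z a))).
  rewrite -colz /col; case: pickP => [kap1 /asboolP //|none].
  by have [kap1 /asboolP] := colour _ zc; rewrite none.
split=> //; exists (range (fun a => T (z a))).
have [d [dv dmin]] := copy_distance_exists finF F'c zc.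
exists d; split=> //.
have : d <= dsup F i j by apply: dmin; exists i, j.
move=> /le_lt_trans; apply; apply: (@le_lt_trans _ _ (iota (e / 2))).
  apply: dsup_le => // [|x]; first by rewrite (iota_ge0 coord) ltW // divr_gt0.
  rewrite -{1}fF => -[a _ <-]; rewrite ip jf -(iota_rnorm coord).
  case: coord => -> _ _; rewrite -(@ler_pXn2r _ 2) ?nnegrE ?(rnorm_ge0 coord) //.
    by rewrite TI.
  by rewrite ltW // divr_gt0.
by rewrite -eE (iota_lt coord) ltr_pdivrMr // ltr_pMr // ltr1n.
Qed.

End Assembly.

Lemma real_scalars_coordinates (R : realType) :
  real_coordinates (idfun : {rmorphism R -> R}) id (fun=> 0).
Proof.
split=> // a b; rewrite real_normK ?num_real //.
by rewrite /= subrr [0 ^+ 2]expr2 mul0r addr0.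
Qed.

Lemma complex_scalars_coordinates (R : realType) :
  real_coordinates (real_complex R : {rmorphism R -> R[i]})
    (@complex.Re R) (@complex.Im R).
Proof.
split=> [a b|a a0|a b]; first exact: lecR.
  exact: (RRe_real (ger0_real a0)).
by rewrite -add_Re2_Im2; case: a => ? ?; case: b => ? ?.
Qed.

Theorem corollary6p17 (R : realType) (K : numFieldType) (conj : K -> K)
    (hK : hilbert_scalars R conj)
    (H : completeNormedModType K) (hH : is_hilbert conj H)
    (hinf : ~ finite_dimensional H)
    (F : set H) (finF : finite_set F)
    (gamma : set (set (set H))) (hgamma : finite_colouring F gamma)
    (G : set H) (finG : finite_set G)
    (eps : K) (heps : 0 < eps) :
  exists2 G' : set H, isometric_copies G G' &
    monochromatic_upto F gamma eps
      [set F' : set H | F' `<=` G' /\ isometric_copies F F'].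
Proof.
case: hK H hH hinf F finF gamma hgamma G finG eps heps =>
  H [dot dotE] hinf F finF gamma hgamma G finG eps heps.
- have conj_norm (a : R) : a * idfun a = `|a| ^+ 2.
    by rewrite real_normK ?num_real.
  exact: (monochromatic_copy (real_scalars_coordinates R) conj_norm dotE).
- have conj_norm (a : R[i]) : a * Num.conj a = `|a| ^+ 2 by rewrite normCK.
  exact: (monochromatic_copy (complex_scalars_coordinates R) conj_norm dotE).
Qed.
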